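(* Let $N$ be a complete Riemannian $m$-manifold. Let $\pi:(\bar{N},\bar{x}_0)\rightarrow (N,x_0)$ be a normal covering with deck transformation group $G$. Then for every $r>0$ we have $$\#(D^G(\bar{x}_0,2r))\cdot \mathrm{Vol}(B_r(x_0))\geq \mathrm{Vol}(B_r(\bar{x}_0))$$ and $$\#(D^G(\bar{x}_0,r))\cdot \mathrm{Vol}(B_r(x_0))\leq \mathrm{Vol}(B_{2r}(\bar{x}_0)).$$
   Context: Manifolds are connected and without boundary; $\bar N$ is connected and carries the pulled-back Riemannian metric, so that $\pi$ is a local isometry and $G$ acts on $\bar N$ by isometries; $\pi(\bar x_0)=x_0$. $B_r(x)$ is the open metric ball of radius $r$ centered at $x$. $D^{G}(\bar x_0,r)=\{g\in G : d(\bar x_0,g(\bar x_0))\leq r\}$, where $d$ is the Riemannian distance of $\bar N$, and $\#(A)$ denotes the number of elements of a set $A$. *)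

(* Defs.v *)
From HB Require Import structures.
From mathcomp Require Import all_boot all_order all_algebra.
From mathcomp Require Import all_classical all_reals all_analysis.
Set Implicit Arguments.
Unset Strict Implicit.
Unset Printing Implicit Defensive.
Import Order.TTheory GRing.Theory Num.Theory.
Import numFieldNormedType.Exports.
Local Open Scope classical_set_scope.
Local Open Scope ring_scope.

Section lebesgue_tuple.
Variable R : realType.
Local Notation T := (measurableTypeR R).

Definition tuple_cons n (p : T * n.-tuple T) : n.+1.-tuple T :=
  [the n.+1.-tuple T of p.1 :: p.2].

Definition tuple_uncons n (t : n.+1.-tuple T) : T * n.-tuple T :=
  (thead t, [tuple of behead t]).

Lemma measurable_tuple_cons n : measurable_fun setT (@tuple_cons n).
Proof. by apply: measurable_cons. Qed.

Lemma measurable_tuple_uncons n : measurable_fun setT (@tuple_uncons n).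
Proof.
apply: measurable_fun_pair; first exact: measurable_tnth.
exact: measurable_behead.
Qed.

Lemma tuple_consK n : cancel (@tuple_cons n) (@tuple_uncons n).
Proof. by case=> x t; congr pair => //; apply/val_inj. Qed.

Section step.
Variables (n : nat) (mu : {sigma_finite_measure set (n.-tuple T) -> \bar R}).

Definition lebesgue_step : set (n.+1.-tuple T) -> \bar R :=
  pushforward ((@lebesgue_measure R) \x mu)%E (@tuple_cons n).

Let step0 : lebesgue_step set0 = 0%E.
Proof. by rewrite /lebesgue_step /pushforward preimage_set0 measure0. Qed.

Let step_ge0 A : (0 <= lebesgue_step A)%E.
Proof. by rewrite /lebesgue_step /pushforward; exact: measure_ge0. Qed.

Let step_sigma_additive : semi_sigma_additive lebesgue_step.
Proof.
exact: (@measure_semi_sigma_additive _ _ _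
  (measure_function_pushforward__canonical__measure_function_Measure
     ((@lebesgue_measure R) \x mu)%E (measurable_tuple_cons (n := n)))).
Qed.

HB.instance Definition _ :=
  isMeasure.Build _ _ _ lebesgue_step step0 step_ge0 step_sigma_additive.

Let step_sigma_finite : sigma_finite setT lebesgue_step.
Proof.
have [F TF Foo] := sigma_finiteT (@lebesgue_measure R).
have [G TG Goo] := sigma_finiteT mu.
pose H k := if unpickle k is Some ij then F ij.1 `*` G ij.2 else set0.
exists (fun k => @tuple_uncons n @^-1` H k).
  apply/esym; rewrite -subTset => t _.
  have [i _ Fi] : (\bigcup_i F i) (tuple_uncons t).1 by rewrite -TF.
  have [j _ Gj] : (\bigcup_j G j) (tuple_uncons t).2 by rewrite -TG.
  by exists (pickle (i, j)) => //=; rewrite /H pickleK.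
move=> k; have mH : measurable (H k).
  rewrite /H; case: unpickle => [[i j]|//].
  by apply: measurableX; [case: (Foo i)|case: (Goo j)].
split.
  by rewrite -[X in measurable X]setTI; exact: measurable_tuple_uncons.
rewrite /lebesgue_step /pushforward -comp_preimage.
rewrite (_ : _ \o _ = id); last by apply/funext => q /=; rewrite tuple_consK.
rewrite /H preimage_id; case: unpickle => [[i j]|]; last by rewrite measure0.
have [mF Fi] := Foo i; have [mG Gj] := Goo j.
by rewrite product_measure1E// lte_mul_pinfty// ge0_fin_numE.
Qed.

HB.instance Definition _ :=
  Measure_isSigmaFinite.Build _ _ _ lebesgue_step step_sigma_finite.
End step.

Fixpoint lebesgue_tuple n : {sigma_finite_measure set (n.-tuple T) -> \bar R} :=
  match n with
  | 0 => \d_([tuple] : 0.-tuple T)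
  | n'.+1 => lebesgue_step (lebesgue_tuple n')
  end.

Lemma lebesgue_tuple_box n (A : 'I_n -> set T) :
  (forall i, measurable (A i)) ->
  lebesgue_tuple n [set t | forall i, A i (tnth t i)] =
  (\prod_(i < n) lebesgue_measure (A i))%E.
Proof.
elim: n A => [|n IH] A mA.
  by rewrite big_ord0 /= diracE mem_set //= => -[].
rewrite big_ord_recl -IH // /= /lebesgue_step /pushforward.
rewrite -product_measure1E //.
  congr (_ _); apply/seteqP; split => -[x t] /=.
    move=> H; split; first exact: (H ord0).
    by move=> i; have := H (lift ord0 i); rewrite tnthS.
  move=> [H1 H2] i; case: (unliftP ord0 i) => [j ->|->].
    by rewrite tnthS.
  exact: H1.
rewrite (_ : [set t | _] = \bigcap_(i in [set: 'I_n])
    ((@tnth n T)^~ i @^-1` A (lift ord0 i))).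
  apply: fin_bigcap_measurable => // i _; rewrite -[X in measurable X]setTI.
  exact: measurable_tnth.
apply/seteqP; split => t Ht i; [move=> _; exact: Ht|exact: (Ht i I)].
Qed.

Definition row_of_tuple n (t : n.-tuple T) : 'rV[R]_n := \row_i tnth t i.

Definition lebesgue_int n (D : set 'rV[R]_n) (f : 'rV[R]_n -> \bar R) : \bar R :=
  (\int[lebesgue_tuple n]_(t in @row_of_tuple n @^-1` D) f (row_of_tuple t))%E.

End lebesgue_tuple.

Fixpoint Ck_on (R : realType) n (W : normedModType R) (k : nat)
    (U : set 'rV[R]_n) (f : 'rV[R]_n -> W) : Prop :=
  match k with
  | 0 => forall x, U x -> {for x, continuous f}
  | k'.+1 => (forall x, U x -> differentiable f x) /\
             forall v, Ck_on k' U (fun x => 'D_v f x)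
  end.

(* Meaningful for U open. *)
Definition smooth_on (R : realType) n (W : normedModType R)
    (U : set 'rV[R]_n) (f : 'rV[R]_n -> W) : Prop :=
  forall k, Ck_on k U f.

(* chart_fun and chart_inv are total; their values outside chart_dom and
   chart_img respectively are irrelevant. *)
Record chart (R : realType) (m : nat) (M : topologicalType) := Chart {
  chart_dom : set M;
  chart_fun :> M -> 'rV[R]_m;
  chart_inv : 'rV[R]_m -> M;
  chart_img := chart_fun @` chart_dom;
  open_chart_dom : open chart_dom;
  open_chart_img : open chart_img;
  chart_funK : forall x, chart_dom x -> chart_inv (chart_fun x) = x;
  continuous_chart_fun : {within chart_dom, continuous chart_fun};
  continuous_chart_inv : {within chart_img, continuous chart_inv}
}.

Definition transition (R : realType) m (M : topologicalType)
    (phi psi : chart R m M) : 'rV[R]_m -> 'rV[R]_m :=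
  psi \o chart_inv phi.

Definition compatible (R : realType) m (M : topologicalType)
    (phi psi : chart R m M) : Prop :=
  smooth_on (phi @` (chart_dom phi `&` chart_dom psi)) (transition phi psi).

(* Connected, without boundary; the atlas is the maximal one.  The carrier is a
   pointed type only because the measurable types of the library are; the
   distinguished point plays no role.  Since 'J f p acts on row vectors on the
   right, metric_transition is the usual tensoriality of the metric. *)
Record riemannian_manifold (R : realType) (m : nat) := RiemannianManifold {
  carrier :> ptopologicalType;
  manifold_hausdorff : hausdorff_space carrier;
  manifold_second_countable : @second_countable carrier;
  manifold_connected : connected [set: carrier];
  atlas : set (chart R m carrier);
  atlas_cover : forall x, exists2 phi, atlas phi & chart_dom phi x;
  atlas_compatible : forall phi psi, atlas phi -> atlas psi ->
    compatible phi psi;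
  atlas_maximal : forall psi,
    (forall phi, atlas phi -> compatible phi psi /\ compatible psi phi) ->
    atlas psi;
  metric : chart R m carrier -> 'rV[R]_m -> 'M[R]_m;
  metric_smooth : forall phi, atlas phi -> smooth_on (chart_img phi) (metric phi);
  metric_sym : forall phi y, atlas phi -> chart_img phi y ->
    (metric phi y)^T = metric phi y;
  metric_pos : forall phi y (v : 'rV[R]_m), atlas phi -> chart_img phi y ->
    v != 0 -> 0 < (v *m metric phi y *m v^T) 0 0;
  metric_transition : forall phi psi x, atlas phi -> atlas psi ->
    chart_dom phi x -> chart_dom psi x ->
    let J := 'J (transition phi psi) (phi x) in
    metric phi (phi x) = J *m metric psi (psi x) *m J^T
}.

Section riemannian_geometry.
Variables (R : realType) (m : nat) (M : riemannian_manifold R m).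

Definition chart_at (x : M) : chart R m M := s2val (cid2 (atlas_cover x)).

Definition C1_on (I : set R) (c : R -> M) : Prop :=
  (forall t, I t -> {for t, continuous c}) /\
  forall phi t, atlas phi -> I t -> chart_dom phi (c t) ->
    derivable (phi \o c) t 1 /\ {for t, continuous (derive1 (phi \o c))}.

(* On each closed piece of the subdivision, c is the restriction of a curve
   that is C^1 on an open set containing that piece. *)
Definition piecewise_C1 (c : R -> M) : Prop :=
  {within `[0, 1], continuous c} /\
  exists (n : nat) (s : nat -> R), [/\ s 0%N = 0, s n = 1 &
    forall i, (i < n)%N -> s i < s i.+1 /\
      exists (I : set R) (b : R -> M),
        [/\ open I, `[s i, s i.+1] `<=` I, C1_on I b &
            forall t, s i <= t <= s i.+1 -> c t = b t]].

Definition speed (c : R -> M) (t : R) : R :=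
  let phi := chart_at (c t) in
  let v := derive1 (phi \o c) t in
  Num.sqrt ((v *m metric phi (phi (c t)) *m v^T) 0 0).

Definition curve_length (c : R -> M) : \bar R :=
  (\int[lebesgue_measure]_(t in `[0%R, 1%R]) (speed c t)%:E)%E.

Definition rdist (x y : M) : \bar R :=
  ereal_inf [set curve_length c | c in
    [set c | [/\ piecewise_C1 c, c 0 = x & c 1 = y]]].

Definition rball (x : M) (r : R) : set M := [set y | (rdist x y < r%:E)%E].

Definition rcomplete : Prop :=
  forall u : nat -> M,
    (forall e : R, 0 < e -> exists n0, forall i j, (n0 <= i)%N -> (n0 <= j)%N ->
       (rdist (u i) (u j) < e%:E)%E) ->
    exists l, forall e : R, 0 < e -> exists n0, forall i, (n0 <= i)%N ->
       (rdist (u i) l < e%:E)%E.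

Definition borel := g_sigma_algebraType (@open M).

(* The Riemannian measure dvol = sqrt(det g) dx^1 ... dx^m: there is exactly one
   Borel measure satisfying this for all charts of the smooth structure. *)
Definition is_riemannian_volume (vol : {measure set borel -> \bar R}) : Prop :=
  forall (phi : chart R m M) (A : set borel),
    atlas phi -> measurable A -> A `<=` chart_dom phi ->
    vol A = lebesgue_int (phi @` A) (fun y => (Num.sqrt (\det (metric phi y)))%:E).

End riemannian_geometry.

Section coverings.
Variables (X Y : topologicalType) (p : X -> Y).

Definition maps_homeomorphically (V : set X) (U : set Y) : Prop :=
  [/\ set_bij V U p, {within V, continuous p} &
    exists2 q : Y -> X, {within U, continuous q} &
      forall x, V x -> q (p x) = x].

Definition evenly_covered (U : set Y) : Prop :=
  exists S : set (set X),
    [/\ forall V, S V -> open V,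
        forall V W, S V -> S W -> V `&` W !=set0 -> V = W,
        \bigcup_(V in S) V = p @^-1` U &
        forall V, S V -> maps_homeomorphically V U].

Definition covering : Prop :=
  [/\ continuous p, set_surj setT setT p &
    forall y, exists U, [/\ open U, U y & evenly_covered U]].

Definition deck : set (X -> X) :=
  [set g | [/\ continuous g, p \o g = p &
    exists2 h : X -> X, continuous h & cancel g h /\ cancel h g]].

Definition normal_covering : Prop :=
  covering /\ forall x x', p x = p x' -> exists2 g, deck g & g x = x'.

End coverings.

(* The smooth structure and the metric of Mb are the ones pulled back from M: the
   local charts phi \o p of Mb, phi a chart of M, are smooth, and the metric has
   in them the same coefficients as in phi. *)
Definition pulled_back_metric (R : realType) m (Mb M : riemannian_manifold R m)
    (p : Mb -> M) : Prop :=
  forall (phi : chart R m M) (psi : chart R m Mb),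
    atlas phi -> chart_dom psi `<=` p @^-1` chart_dom phi ->
    (forall x, chart_dom psi x -> psi x = phi (p x)) ->
    atlas psi /\ forall y, chart_img psi y -> metric psi y = metric phi y.

Definition deck_disp (R : realType) m (Mb M : riemannian_manifold R m)
    (p : Mb -> M) (x : Mb) (r : R) : set (Mb -> Mb) :=
  [set g | deck p g /\ (rdist x (g x) <= r%:E)%E].

(* Main.v *)
Require Import Defs.
From mathcomp Require Import all_boot all_order all_algebra.
From mathcomp Require Import all_classical all_reals all_analysis.
From mathcomp Require Import measurable_realfun lra.
Set Implicit Arguments.
Unset Strict Implicit.
Unset Printing Implicit Defensive.
Import Order.TTheory GRing.Theory Num.Theory.
Import numFieldNormedType.Exports.
Local Open Scope classical_set_scope.
Local Open Scope ring_scope.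

(** Write [d] for the distance of [Nb] and, for a Borel set [E] of [Nb], let
[n_E y] be the number of points of [E] above [y].  Cutting [Nb] into countably
many Borel pieces on which [p] is injective and preserves the volume gives
[volb E = \int n_E] ([measure_fiber_counting], [patch_partition]).  Both
inequalities then become pointwise comparisons of [n_E] with a number of deck
transformations times the indicator function of the ball [B_r(x0)].

For the first one, [E = B_r(xb0)].  The projection does not increase distances,
so [n_E] vanishes outside [B_r(x0)].  If [z] lies in [E], normality says that
every other point of [E] above [p z] is [g z] for a deck transformation [g], and
[d(xb0, g xb0) <= d(xb0, g z) + d(g z, g xb0) < 2r]; hence [n_E] is at most the
number of deck transformations of displacement [<= 2r].

For the second one, [E = B_2r(xb0)].  A point [y] of [B_r(x0)] lifts to some [z]
in [B_r(xb0)], because a short curve from [x0] to [y] lifts to a curve of the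
same length.  If [g] displaces [xb0] by at most [r], then [g z] lies in [E] by
the triangle inequality; distinct [g] give distinct points [g z], since a deck
transformation is determined by one value.

What has to be developed is the behaviour of the distance: the triangle
inequality and symmetry, its invariance under deck transformations, its
compatibility with projection and lifting, and the openness of balls, without
which their volumes would make no sense.  All of it is obtained from
[rdist_ltP], which describes the distance by finite chains of C^1 segments. *)

(** * Quadratic forms and derivatives along curves *)

Section matrix_calculus.
Variables (R : realType) (m : nat).

Definition qform (G : 'M[R]_m) (v : 'rV[R]_m) : R := (v *m G *m v^T) 0 0.

Lemma qformE G v : qform G v = \sum_i \sum_j v 0 j * G j i * v 0 i.
Proof.
rewrite /qform !mxE; apply: eq_bigr => i _.
by rewrite !mxE mulr_suml.
Qed.

Lemma qform_mulmx (G J : 'M[R]_m) v : qform G (v *m J) = qform (J *m G *m J^T) v.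
Proof. by rewrite /qform trmx_mul !mulmxA. Qed.

Lemma qformZ (k : R) G v : qform G (k *: v) = k ^+ 2 * qform G v.
Proof.
by rewrite /qform linearZ/= -!scalemxAl -scalemxAr !mxE mulrA expr2.
Qed.

Lemma cvg_coord (T : Type) (F : set_system T) (FF : Filter F) n k
    (A : T -> 'M[R]_(n, k)) (a : 'M[R]_(n, k)) i j :
  A x @[x --> F] --> a -> A x i j @[x --> F] --> a i j.
Proof. by move=> Aa; exact: (cvg_comp _ _ Aa (@coord_continuous _ _ _ i j a)). Qed.

Lemma cvg_sumr (W : normedModType R) (T : Type) (F : set_system T)
    (FF : Filter F) n (f : 'I_n -> T -> W) (l : 'I_n -> W) :
  (forall i, f i x @[x --> F] --> l i) ->
  \sum_i f i x @[x --> F] --> \sum_i l i.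
Proof.
by move=> fl; apply: (cvg_big (x0 := 0) add_continuous) => i _; exact: fl.
Qed.

Lemma cvg_qform (T : Type) (F : set_system T) (FF : Filter F)
    (G : T -> 'M[R]_m) (v : T -> 'rV[R]_m) (g : 'M[R]_m) (w : 'rV[R]_m) :
  G x @[x --> F] --> g -> v x @[x --> F] --> w ->
  qform (G x) (v x) @[x --> F] --> qform g w.
Proof.
move=> Gg vw; under eq_fun do rewrite qformE.
rewrite qformE.
apply: cvg_sumr => i; apply: cvg_sumr => j.
by apply: cvgM; [apply: cvgM|]; exact: cvg_coord.
Qed.

(** Expanding the velocity [v] in the standard basis reduces the joint continuity
of the derivative of [f] to that of its directional derivatives in fixed
directions, which is what [smooth_on] provides. *)
Lemma cvg_derive_along (W : normedModType R) (f : 'rV[R]_m -> W)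
    (T : Type) (F : set_system T) (FF : Filter F)
    (x v : T -> 'rV[R]_m) (x0 v0 : 'rV[R]_m) :
  (forall w, {for x0, continuous (fun y => 'D_w f y)}) ->
  differentiable f x0 -> (\forall t \near F, differentiable f (x t)) ->
  x t @[t --> F] --> x0 -> v t @[t --> F] --> v0 ->
  'D_(v t) f (x t) @[t --> F] --> 'D_v0 f x0.
Proof.
move=> cf df0 df xx0 vv0.
have E y w : differentiable f y ->
    'D_w f y = \sum_j w 0 j *: 'D_(delta_mx 0 j) f y.
  move=> dfy; rewrite deriveE// {1}(row_sum_delta w) linear_sum/=.
  by apply: eq_bigr => j _; rewrite linearZ/= deriveE.
suff lim_l l : l = \sum_j v0 0 j *: 'D_(delta_mx 0 j) f x0 ->
    'D_(v t) f (x t) @[t --> F] --> l by exact: lim_l (E _ _ df0).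
move=> ->.
have vx : \sum_j v t 0 j *: 'D_(delta_mx 0 j) f (x t) @[t --> F] -->
    \sum_j v0 0 j *: 'D_(delta_mx 0 j) f x0; last first.
  apply: cvg_trans vx; apply: near_eq_cvg; near=> t; apply/esym/E.
  by near: t; exact: df.
apply: cvg_sumr => j.
apply: cvgZ; first exact: cvg_coord.
exact: cvg_comp xx0 (cf _).
Unshelve. all: by end_near. Qed.

End matrix_calculus.

Section charts.
Variables (R : realType) (m : nat) (M : topologicalType).
Implicit Types (phi psi : chart R m M) (x : M).

Lemma chart_dom_nbhs phi x : chart_dom phi x -> nbhs x (chart_dom phi).
Proof. by move=> ?; apply: open_nbhs_nbhs; split => //; exact: open_chart_dom. Qed.

Lemma chart_continuous phi x : chart_dom phi x -> {for x, continuous phi}.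
Proof.
move=> xphi; have := @continuous_chart_fun _ _ _ phi.
by rewrite continuous_open_subspace; [apply; exact/mem_set|exact: open_chart_dom].
Qed.

Lemma chart_inv_continuous phi y :
  chart_img phi y -> {for y, continuous (chart_inv phi)}.
Proof.
move=> yphi; have := @continuous_chart_inv _ _ _ phi.
by rewrite continuous_open_subspace; [apply; exact/mem_set|exact: open_chart_img].
Qed.

Lemma chart_invK phi y : chart_img phi y -> phi (chart_inv phi y) = y.
Proof. by move=> [x xphi <-]; rewrite chart_funK. Qed.

Lemma chart_inv_dom phi y : chart_img phi y -> chart_dom phi (chart_inv phi y).
Proof. by move=> [x xphi <-]; rewrite chart_funK. Qed.

Lemma transitionE phi psi x : chart_dom phi x ->
  transition phi psi (phi x) = psi x.
Proof. by move=> xphi; rewrite /transition/= chart_funK. Qed.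

End charts.

(** * Curves in a Riemannian manifold *)

Section curves.
Variables (R : realType) (m : nat) (M : riemannian_manifold R m).
Implicit Types (phi psi : chart R m M) (c : R -> M) (t : R).

Lemma near_curve_dom phi c t : {for t, continuous c} -> chart_dom phi (c t) ->
  \forall u \near t, chart_dom phi (c u).
Proof. by move=> cc ctphi; apply: cc; exact: chart_dom_nbhs. Qed.

Lemma transition_differentiable phi psi x : atlas phi -> atlas psi ->
  chart_dom phi x -> chart_dom psi x ->
  differentiable (transition phi psi) (phi x).
Proof.
move=> aphi apsi xphi xpsi.
by have [+ _] := atlas_compatible aphi apsi 1%N; apply; exists x.
Qed.

Lemma transition_C1 phi psi x w : atlas phi -> atlas psi ->
  chart_dom phi x -> chart_dom psi x ->
  {for phi x, continuous (fun y => 'D_w (transition phi psi) y)}.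
Proof.
move=> aphi apsi xphi xpsi.
by have [_ +] := atlas_compatible aphi apsi 1%N; move=> /(_ w)/=; apply; exists x.
Qed.

Lemma derivable_change_chart phi psi c t : atlas phi -> atlas psi ->
  {for t, continuous c} -> chart_dom phi (c t) -> chart_dom psi (c t) ->
  derivable (phi \o c) t 1 ->
  derivable (psi \o c) t 1 /\
  derive1 (psi \o c) t =
    'D_(derive1 (phi \o c) t) (transition phi psi) (phi (c t)).
Proof.
move=> aphi apsi cc ctphi ctpsi /derivable1_diffP dc.
have dT := transition_differentiable aphi apsi ctphi ctpsi.
have E : {near t, transition phi psi \o (phi \o c) =1 psi \o c}.
  by near=> u => /=; rewrite transitionE//; near: u; exact: near_curve_dom.
have dTc : differentiable (transition phi psi \o (phi \o c)) t.
  exact: differentiable_comp.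
have ? : derivable (psi \o c) t 1.
  by apply: near_eq_derivable E _; apply/derivable1_diffP.
split; first by [].
rewrite derive1E -(near_eq_derive _ E) deriveE// diff_comp//=.
by rewrite deriveE// derive1E'.
Unshelve. all: by end_near. Qed.

(** The transition maps are C^1, so by the chain rule a curve that is C^1 in one
chart around a point is C^1 in all of them. *)
Lemma C1_onP (I : set R) c : open I ->
  (forall t, I t -> {for t, continuous c}) ->
  (forall t, I t -> exists phi, [/\ atlas phi, chart_dom phi (c t),
     \forall u \near t, derivable (phi \o c) u 1 &
     {for t, continuous (derive1 (phi \o c))}]) ->
  C1_on I c.
Proof.
move=> oI cc H; split; first exact: cc.
move=> psi t apsi It ctpsi.
have [phi [aphi ctphi dphi cphi]] := H t It.
have dpsi := derivable_change_chart aphi apsi (cc t It) ctphi ctpsi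
  (nbhs_singleton dphi).
split; first by case: dpsi.
rewrite /prop_for /continuous_at; case: dpsi => _ ->.
have near_I : \forall u \near t, I u by apply: open_nbhs_nbhs; split.
have near_phi := near_curve_dom (cc t It) ctphi.
have near_psi := near_curve_dom (cc t It) ctpsi.
apply: cvg_trans (_ : (fun u => 
    'D_(derive1 (phi \o c) u) (transition phi psi) (phi (c u))) @ t --> _); last first.
  apply: cvg_derive_along.
  - by move=> w; exact: transition_C1.
  - exact: transition_differentiable.
  - by near=> u; apply: transition_differentiable => //; near: u.
  - by apply: continuous_comp; [exact: cc|exact: chart_continuous].
  - exact: cphi.
apply: near_eq_cvg; near=> u.
have [||||_ ->] := derivable_change_chart aphi apsi (c := c) (t := u); last by [].
- by apply: cc; near: u.
- by near: u.
- by near: u.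
- by near: u.
Unshelve. all: by end_near. Qed.

(** The Jacobian of the transition map that transforms the velocity is absorbed
by the transformation rule of the metric, so that [speed] may be computed in any
chart and not only in the one it selects. *)
Lemma speedE phi c t : atlas phi -> {for t, continuous c} ->
  chart_dom phi (c t) -> derivable (phi \o c) t 1 ->
  speed c t = Num.sqrt (qform (metric phi (phi (c t))) (derive1 (phi \o c) t)).
Proof.
move=> aphi cc ctphi dc; rewrite /speed.
have aat : atlas (chart_at (c t)) by rewrite /chart_at; case: cid2.
have ctat : chart_dom (chart_at (c t)) (c t) by rewrite /chart_at; case: cid2.
move: (chart_at (c t)) aat ctat => psi apsi ctpsi.
have [_ ->] := derivable_change_chart aphi apsi cc ctphi ctpsi dc.
rewrite -/(qform _ _).
rewrite deriveEjacobian; last exact: transition_differentiable.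
by rewrite qform_mulmx -metric_transition.
Qed.

Lemma C1_on_near_derivable (I : set R) c phi t : open I -> C1_on I c ->
  atlas phi -> I t -> chart_dom phi (c t) ->
  \forall u \near t, derivable (phi \o c) u 1.
Proof.
move=> oI [cc C1] aphi It ctphi.
have near_I : \forall u \near t, I u by apply: open_nbhs_nbhs; split.
have near_phi := near_curve_dom (cc t It) ctphi.
near=> u.
have [//||//] := C1 phi u aphi; first by near: u.
by near: u.
Unshelve. all: by end_near. Qed.

Lemma metric_continuous phi y : atlas phi -> chart_img phi y ->
  {for y, continuous (metric phi)}.
Proof. by move=> aphi; exact: (metric_smooth aphi 0%N). Qed.

Lemma speed_continuous (I : set R) c t : open I -> C1_on I c -> I t ->
  {for t, continuous (speed c)}.
Proof.
move=> oI C1 It; have [cc dc] := C1.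
have [phi aphi ctphi] := atlas_cover (c t).
have [dct cct] := dc phi t aphi It ctphi.
have near_I : \forall u \near t, I u by apply: open_nbhs_nbhs; split.
have near_phi := near_curve_dom (cc t It) ctphi.
rewrite /prop_for /continuous_at (speedE aphi (cc t It) ctphi dct).
apply: cvg_trans (_ : (fun u => Num.sqrt (qform (metric phi (phi (c u)))
   (derive1 (phi \o c) u))) @ t --> _).
  apply: near_eq_cvg; near=> u.
  have Iu : I u by near: u.
  have uphi : chart_dom phi (c u) by near: u.
  by have [du _] := dc phi u aphi Iu uphi; rewrite (speedE aphi (cc u Iu) uphi du).
apply: cvg_comp; last exact: sqrt_continuous.
apply: cvg_qform; last exact: cct.
apply: (@continuous_comp _ _ _ (phi \o c) (metric phi)).
  by apply: continuous_comp; [exact: cc|exact: chart_continuous].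
by apply: metric_continuous => //; exists (c t).
Unshelve. all: by end_near. Qed.

Lemma speed_ge0 c t : 0 <= speed c t.
Proof. exact: sqrtr_ge0. Qed.

Lemma speed_near c d t : {near t, c =1 d} -> speed c t = speed d t.
Proof.
move=> cd; have E := nbhs_singleton cd.
rewrite /speed E; set phi := chart_at _.
suff -> : derive1 (phi \o c) t = derive1 (phi \o d) t by [].
rewrite !derive1E; apply: near_eq_derive; near=> u => /=; congr (phi _).
by near: u.
Unshelve. all: by end_near. Qed.

End curves.

(** * Length of arcs *)

Section integral_concatenation.
Variable R : realType.
Local Notation mu := (@lebesgue_measure R).

Lemma integral_itv_cat (f : R -> R) (a s e : R) : a <= s -> s <= e ->
  (forall t, 0 <= f t) -> measurable_fun `[a, s] f -> measurable_fun `[s, e] f ->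
  measurable_fun `[a, e] f /\
  (\int[mu]_(t in `[a, e]) (f t)%:E =
   \int[mu]_(t in `[a, s]) (f t)%:E + \int[mu]_(t in `[s, e]) (f t)%:E)%E.
Proof.
move=> ale_s sle_e f0 mf1 mf2.
have mf2' : measurable_fun `]s, e] f.
  by apply: measurable_funS mf2 => //; apply: subset_itvr; rewrite bnd_simp.
have E : `[a, e]%classic = `[a, s] `|` `]s, e] :> set R.
  by rewrite -itv_bndbnd_setU// bnd_simp.
have mf : measurable_fun (`[a, s] `|` `]s, e]) f by apply/measurable_funU.
rewrite E; split => //.
rewrite ge0_integral_setU//=.
- congr (_ + _)%E; apply: integral_itv_obnd_cbnd; exact/measurable_EFinP.
- exact/measurable_EFinP.
- by move=> t _; rewrite lee_fin.
- rewrite disj_set2E; apply/eqP/seteqP; split => t //=; rewrite !in_itv/=.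
  by move=> [/andP[_ ts] /andP[st _]]; move: (le_lt_trans ts st); rewrite ltxx.
Qed.

(** The two functions may differ at the end points: the speed of a concatenation
is not controlled at the gluing points. *)
Lemma eq_integral_itv (f g : R -> R) (a e : R) :
  (forall t, a < t < e -> f t = g t) -> measurable_fun `[a, e] g ->
  measurable_fun `[a, e] f /\
  (\int[mu]_(t in `[a, e]) (f t)%:E = \int[mu]_(t in `[a, e]) (g t)%:E)%E.
Proof.
move=> fg mg.
have mg' : measurable_fun `]a, e[ g.
  by apply: measurable_funS mg => //; exact: subset_itv_oo_cc.
have mf' : measurable_fun `]a, e[ f.
  apply: eq_measurable_fun mg' => t; rewrite inE/= in_itv/= => tae.
  by rewrite fg.
split; first exact: measurable_fun_itv_cc mf'.
rewrite [LHS]integral_itv_bndoo; last exact/measurable_EFinP.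
rewrite [RHS]integral_itv_bndoo; last exact/measurable_EFinP.
by apply: eq_integral => t; rewrite inE/= in_itv/= => tae; rewrite fg.
Qed.

Lemma continuous_integral_fin (f : R -> R) (a e : R) :
  {within `[a, e], continuous f} -> (forall t, 0 <= f t) ->
  exists L, (\int[mu]_(t in `[a, e]) (f t)%:E)%E = L%:E.
Proof.
move=> cf f0; exists (fine (\int[mu]_(t in `[a, e]) (f t)%:E)%E).
rewrite fineK//; apply: integrable_fin_num => //.
by apply: continuous_compact_integrable => //; exact: segment_compact.
Qed.

(** The slope may be negative, in which case the end points are exchanged; this
is what reversing a curve requires. *)
Lemma integral_affine (f : R -> R) (k b a e : R) : k != 0 -> a < e ->
  let a' := Num.min (k * a + b) (k * e + b) in
  let e' := Num.max (k * a + b) (k * e + b) in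
  {within `[a', e'], continuous f} ->
  (\int[mu]_(t in `[a', e']) (f t)%:E =
   \int[mu]_(t in `[a, e]) (`|k| * f (k * t + b)%R)%:E)%E.
Proof.
move=> k0 ae a' e' cf.
pose F := fun t : R => k * t + b.
have dF (t : R) : is_derive t (1 : R) F k.
  have -> : F = k *: id + cst b by apply/funext.
  by apply: is_derive_eq; rewrite addr0 [LHS]mulr1.
have dFE : derive1 F = cst k by apply/funext => t; rewrite derive1E derive_val.
have cF : derivable_oo_LRcontinuous F a e.
  have cF t : {for t, continuous F}.
    by apply: differentiable_continuous; apply/derivable1_diffP.
  split; first by move=> t _; exact: ex_derive.
    exact: cvg_at_right_filter (cF a).
  exact: cvg_at_left_filter (cF e).
have [kp|kn] := ltP 0 k.
  have FF : F a < F e by rewrite ltrD2r ltr_pM2l.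
  have a'E : a' = F a by rewrite /a' min_l// ltW.
  have e'E : e' = F e by rewrite /e' max_r// ltW.
  rewrite a'E e'E in cf *.
  rewrite (integration_by_substitution_increasing (ltW ae) _ _ _ _ cF cf).
  - by apply: eq_integral => t _; rewrite dFE/= gtr0_norm// mulrC.
  - by move=> x y _ _ xy; rewrite ltrD2r ltr_pM2l.
  - by move=> x _; rewrite dFE; exact: cst_continuous.
  - by rewrite dFE; exact: is_cvg_cst.
  - by rewrite dFE; exact: is_cvg_cst.
have {}kn : k < 0 by rewrite lt_neqAle k0.
have FF : F e < F a by rewrite ltrD2r ltr_nM2l.
have a'E : a' = F e by rewrite /a' min_r// ltW.
have e'E : e' = F a by rewrite /e' max_l// ltW.
rewrite a'E e'E in cf *.
rewrite (integration_by_substitution_decreasing (ltW ae) _ _ _ _ cF cf).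
- by apply: eq_integral => t _; rewrite dFE/= ltr0_norm// mulrC.
- by move=> x y _ _ xy; rewrite ltrD2r ltr_nM2l.
- by move=> x _; rewrite dFE; exact: cst_continuous.
- by rewrite dFE; exact: is_cvg_cst.
- by rewrite dFE; exact: is_cvg_cst.
Qed.

End integral_concatenation.

Section arcs.
Variables (R : realType) (m : nat) (M : riemannian_manifold R m).
Implicit Types (b c : R -> M) (x y z : M).

(** The open interval [I] gives a meaning to derivatives at the end points and
makes the speed continuous on the closed interval. *)
Definition C1_arc (a e : R) b :=
  exists I : set R, [/\ open I, `[a, e] `<=` I & C1_on I b].

Definition arc_length (a e : R) c : \bar R :=
  (\int[lebesgue_measure]_(t in `[a, e]) (speed c t)%:E)%E.

Lemma C1_arc_continuous a e b : C1_arc a e b -> {within `[a, e], continuous b}.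
Proof.
move=> [I [oI aeI [cb _]]].
by apply: continuous_in_subspaceT => t /set_mem tae; exact/cb/aeI.
Qed.

Lemma C1_arc_speed_continuous a e b :
  C1_arc a e b -> {within `[a, e], continuous (speed b)}.
Proof.
move=> [I [oI aeI C1]].
apply: continuous_in_subspaceT => t /set_mem tae.
exact: speed_continuous oI C1 (aeI _ tae).
Qed.

Lemma C1_arc_length_fin a e b : C1_arc a e b ->
  exists L, arc_length a e b = L%:E.
Proof.
move=> /C1_arc_speed_continuous cb; apply: continuous_integral_fin cb _ => t.
exact: speed_ge0.
Qed.

(** Only the inside of the interval matters: [c] may be arbitrary outside
[[a, e]], where [derive1] would see it at the end points. *)
Lemma arc_length_eq a e b c : C1_arc a e b ->
    (forall t, a <= t <= e -> c t = b t) ->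
  measurable_fun `[a, e] (speed c) /\ arc_length a e c = arc_length a e b.
Proof.
move=> /C1_arc_speed_continuous cb bc.
apply: eq_integral_itv; last first.
  by apply: subspace_continuous_measurable_fun.
move=> t /andP[at_ te]; apply: speed_near; near=> u; apply: bc.
apply/andP; split; apply: ltW; near: u; [exact: lt_nbhsr|exact: lt_nbhsl].
Unshelve. all: by end_near. Qed.

Lemma derive_affine_comp (V : normedModType R) (f : R -> V) (k d t : R) :
  derivable f (k * t + d) 1 ->
  derivable (fun u : R => f (k * u + d)) t 1 /\
  derive1 (fun u : R => f (k * u + d)) t = k *: derive1 f (k * t + d).
Proof.
move=> df; pose F := fun u : R => k * u + d.
have [dF F'] : is_derive (t : R) (1 : R) F k.
  have -> : F = k *: id + cst d by apply/funext.
  by apply: is_derive_eq; rewrite addr0 [LHS]mulr1.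
have {}dF : differentiable F t by apply/derivable1_diffP.
have {}df : differentiable f (F t) by apply/derivable1_diffP.
have dfF : differentiable (f \o F) t by exact: differentiable_comp.
split; first by apply/derivable1_diffP.
rewrite [LHS](derive1E' dfF) diff_comp//= -!deriveE// F'.
by rewrite -[k in LHS]mulr1 deriveE// linearZ/= derive1E'.
Qed.

Lemma affine_continuous (k d : R) : continuous (fun t : R => k * t + d).
Proof.
by move=> t; apply: cvgD; [apply: cvgM; [exact: cvg_cst|exact: cvg_id]|exact: cvg_cst].
Qed.

Lemma near_affine (k d t : R) (P : R -> Prop) :
  (\forall u \near k * t + d, P u) -> \forall u \near t, P (k * u + d).
Proof. exact: (affine_continuous (x := t)). Qed.

Lemma C1_on_affine (I : set R) b (k d : R) : open I -> C1_on I b ->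
  C1_on [set t | I (k * t + d)] (fun t => b (k * t + d)).
Proof.
move=> oI C1; have [cb db] := C1; split => [t /= It|phi t aphi /= It tphi].
  by apply: continuous_comp; [exact: affine_continuous|exact: cb].
have [dt ct] := db phi _ aphi It tphi.
have [dt' Et] := derive_affine_comp dt.
split; first exact: dt'.
rewrite /prop_for /continuous_at [X in _ --> X]Et.
apply: cvg_trans (_ : (fun u : R => k *: derive1 (phi \o b) (k * u + d)) @ t --> _).
  apply: near_eq_cvg.
  have near_d : \forall u \near t, derivable (phi \o b) (k * u + d) 1.
    apply: (near_affine (P := fun u => derivable (phi \o b) u 1)).
    exact: C1_on_near_derivable C1 aphi It tphi.
  near=> u; have du : derivable (phi \o b) (k * u + d) 1 by near: u.
  by have [_ /esym] := derive_affine_comp du.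
apply: cvgZ; first exact: cvg_cst.
by apply: continuous_comp; [exact: affine_continuous|exact: ct].
Unshelve. all: by end_near. Qed.

Lemma speed_affine (I : set R) b (k d t : R) : open I -> C1_on I b ->
  I (k * t + d) -> speed (fun u => b (k * u + d)) t = `|k| * speed b (k * t + d).
Proof.
move=> oI C1 It; have [cb db] := C1.
have [phi aphi tphi] := atlas_cover (b (k * t + d)).
have [dt _] := db phi _ aphi It tphi.
have [dt' Et] := derive_affine_comp dt.
rewrite (speedE aphi _ tphi dt'); last first.
  by apply: continuous_comp; [exact: affine_continuous|exact: cb].
rewrite (speedE aphi (cb _ It) tphi dt) [derive1 _ t]Et qformZ.
by rewrite sqrtrM ?sqr_ge0// sqrtr_sqr.
Qed.

(** Invariance of the length under affine changes of parameter, including those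
that reverse the orientation. *)
Lemma C1_arc_affine b (k d a e : R) : k != 0 -> a < e ->
  let a' := Num.min (k * a + d) (k * e + d) in
  let e' := Num.max (k * a + d) (k * e + d) in
  C1_arc a' e' b ->
  C1_arc a e (fun t => b (k * t + d)) /\
  arc_length a e (fun t => b (k * t + d)) = arc_length a' e' b.
Proof.
move=> k0 ae a' e' arcb; have [I [oI aeI C1]] := arcb.
have sub t : a <= t <= e -> a' <= k * t + d <= e'.
  move=> /andP[at_ te]; rewrite /a' /e' ge_min le_max !lerD2r.
  have [k_gt0|k_le0] := ltP 0 k; first by rewrite !ler_pM2l// at_ te orbT.
  by rewrite (ler_wnM2l k_le0 te) (ler_wnM2l k_le0 at_) orbT.
split.
  exists [set t | I (k * t + d)]; split.
  - by apply: open_comp => // t _; exact: affine_continuous.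
  - by move=> t /=; rewrite in_itv/= => /sub tae; apply: aeI; rewrite /= in_itv.
  - exact: C1_on_affine.
rewrite /arc_length integral_affine//; last exact: C1_arc_speed_continuous arcb.
apply: eq_integral => t; rewrite inE/= in_itv/= => /sub tae.
by rewrite (speed_affine oI C1)//; apply: aeI; rewrite /= in_itv.
Qed.

(** The parameter interval is forgotten: by [seg_param] it can be prescribed. *)
Definition seg x y (L : R) := exists (a e : R) b,
  [/\ a < e, C1_arc a e b, b a = x, b e = y & arc_length a e b = L%:E].

Lemma seg_param x y L (a e : R) : a < e -> seg x y L ->
  exists b, [/\ C1_arc a e b, b a = x, b e = y & arc_length a e b = L%:E].
Proof.
move=> ae [a' [e' [b [ae' arcb ba be bL]]]].
pose k := (e' - a') / (e - a); pose d := a' - k * a.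
have ea0 : 0 < e - a by rewrite subr_gt0.
have k0 : 0 < k by rewrite divr_gt0// subr_gt0.
have Ea : k * a + d = a' by rewrite /d addrC subrK.
have Ee : k * e + d = e'.
  by rewrite /d addrCA -mulrBr /k divfK ?gt_eqF// addrC subrK.
have := @C1_arc_affine b k d a e; rewrite Ea Ee min_l ?ltW// max_r ?ltW//.
move=> /(_ (lt0r_neq0 k0) ae arcb)[arcb' L'].
exists (fun t => b (k * t + d)).
by split; [exact: arcb'|rewrite Ea|rewrite Ee|rewrite L' bL].
Qed.

Lemma seg_sym x y L : seg x y L -> seg y x L.
Proof.
move=> [a [e [b [ae arcb ba be bL]]]].
have := @C1_arc_affine b (-1) 0 (- e) (- a).
rewrite !addr0 !mulN1r !opprK min_r ?ltW// max_l ?ltW// oppr_eq0 oner_eq0 ltrN2.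
move=> /(_ isT ae arcb)[arcb' L'].
exists (- e), (- a), (fun t => b (-1 * t + 0)).
split; [by rewrite ltrN2|exact: arcb'|..|by rewrite L' bL].
  by rewrite mulN1r opprK addr0.
by rewrite mulN1r opprK addr0.
Qed.

(** A piecewise C^1 path whose pieces keep independent parametrisations, so that
concatenating or transforming paths involves no subdivision of [[0, 1]]. *)
Inductive chain : M -> M -> R -> Prop :=
| chain_nil x : chain x x 0
| chain_cons x y z L K : seg x y L -> chain y z K -> chain x z (L + K).

Lemma chain_cat x y z L K : chain x y L -> chain y z K -> chain x z (L + K).
Proof.
move=> cxy; elim: cxy z K => [w z K|w1 w2 w3 L1 L2 s12 _ IH z K c3].
  by rewrite add0r.
by rewrite -addrA; apply: chain_cons s12 _; exact: IH.
Qed.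

Lemma chain_seg x y L : seg x y L -> chain x y L.
Proof. by move=> s; rewrite -[L]addr0; apply: chain_cons s _; exact: chain_nil. Qed.

Lemma chain_sym x y L : chain x y L -> chain y x L.
Proof.
elim=> [w|w1 w2 w3 L1 L2 s12 _ IH]; first exact: chain_nil.
by rewrite addrC; apply: chain_cat IH _; exact/chain_seg/seg_sym.
Qed.

End arcs.

(** * The distance through chains of segments *)

Lemma itv_cc_cat (R : realType) (a h e : R) : a <= h -> h <= e ->
  `[a, e]%classic = `[a, h] `|` `[h, e] :> set R.
Proof.
move=> ah he; apply/seteqP; split => t /=; rewrite !in_itv/=.
  move=> /andP[at_ te]; case: (leP t h) => th; [left|right].
    by rewrite at_.
  by rewrite te andbT ltW.
move=> [/andP[at_ th]|/andP[ht te]].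
  by rewrite at_ (le_trans th he).
by rewrite te (le_trans ah ht).
Qed.

Section distance.
Variables (R : realType) (m : nat) (M : riemannian_manifold R m).
Implicit Types (b c : R -> M) (x y z : M).

(** Building a curve on [[0, 1]] from a chain proceeds by halving the interval,
hence the arbitrary parameter interval. *)
Definition piecewise_C1_on (a e : R) c := {within `[a, e], continuous c} /\
  exists (n : nat) (s : nat -> R), [/\ s 0%N = a, s n = e &
    forall i, (i < n)%N -> s i < s i.+1 /\
      exists2 b, C1_arc (s i) (s i.+1) b &
                 forall t, s i <= t <= s i.+1 -> c t = b t].

Lemma piecewise_C1E c : piecewise_C1 c <-> piecewise_C1_on 0 1 c.
Proof.
split=> -[cc [n [s [s0 sn sP]]]]; split => //; exists n, s; split => // i ltin.
  have [sii [I [b [oI sI C1 cb]]]] := sP i ltin.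
  by split => //; exists b => //; exists I; split.
have [sii [b [I [oI sI C1]] cb]] := sP i ltin.
by split => //; exists I, b; split.
Qed.

Lemma subdivision_le (n : nat) (s : nat -> R) i j :
  (forall i, (i < n)%N -> s i < s i.+1) -> (i <= j <= n)%N -> s i <= s j.
Proof.
move=> s_lt; elim: j => [|j IH]; first by rewrite leqn0 => /andP[/eqP ->].
rewrite leq_eqVlt ltnS => /andP[/predU1P[-> _//|ij jn]].
by rewrite (le_trans (IH _)) ?ij ?(ltnW jn)// ltW// s_lt.
Qed.

(** Each piece of the subdivision is a segment, and the length is additive. *)
Lemma piecewise_C1_chain c (a e : R) : piecewise_C1_on a e c ->
  exists2 L, chain (c a) (c e) L & arc_length a e c = L%:E.
Proof.
move=> [_ [n [s [<- <- sP]]]].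
have s_lt i : (i < n)%N -> s i < s i.+1 by move=> /sP[].
suff H : forall i, (i <= n)%N ->
    measurable_fun `[s 0%N, s i] (speed c) /\
    exists2 L, chain (c (s 0%N)) (c (s i)) L & arc_length (s 0%N) (s i) c = L%:E.
  by have [_] := H n (leqnn n).
elim=> [_|i IH ltin].
  rewrite /arc_length set_itv1; split; first exact: measurable_fun_set1.
  by exists 0; [exact: chain_nil|rewrite integral_set1].
have s0i : s 0%N <= s i := subdivision_le s_lt (ltnW ltin : (0 <= i <= n)%N).
have [mc [L cL lenL]] := IH (ltnW ltin).
have [sii [b arcb cb]] := sP i ltin.
have [K lenK] := C1_arc_length_fin arcb.
have [mb lenb] := arc_length_eq arcb cb.
have [mf E] := integral_itv_cat s0i (ltW sii) (speed_ge0 c) mc mb.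
split; first exact: mf.
exists (L + K).
  apply: chain_cat cL _; apply: chain_seg; exists (s i), (s i.+1), b.
  have ss := ltW sii; split; [exact: sii|exact: arcb|..|exact: lenK].
    by rewrite cb ?lexx.
  by rewrite cb ?lexx ?ss.
by rewrite {1}/arc_length E -!/(arc_length _ _ _) lenL lenb lenK.
Qed.

(** The constant curve realises the empty chain. *)
Lemma C1_arc_cst (a e : R) x : C1_arc a e (cst x) /\
  arc_length a e (cst x) = 0%:E.
Proof.
have d0 phi t : derivable (phi \o cst x : R -> 'rV[R]_m) t (1 : R) /\
    derive1 (phi \o cst x : R -> 'rV[R]_m) t = 0.
  rewrite (_ : _ \o _ = cst (phi x))//.
  by split; [exact: derivable_cst|exact: derive1_cst].
split.
  exists setT; split; [exact: openT|exact: subsetT|split=> [t _|phi t _ _ _]].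
    exact: cvg_cst.
  split; first by have [] := d0 phi t.
  rewrite (_ : derive1 _ = cst 0); last by apply/funext => u; have [] := d0 phi u.
  exact: cvg_cst.
rewrite /arc_length integral0_eq// => t _.
have [_ d] := d0 (chart_at x) t.
by rewrite /speed/= d mul0mx mul0mx mxE sqrtr0.
Qed.

(** The first segment is put on the left half of the interval and, inductively,
the rest of the chain on the right half. *)
Lemma chain_piecewise_C1 x y L : chain x y L -> forall a e : R, a < e ->
  exists c, [/\ piecewise_C1_on a e c, c a = x, c e = y &
    measurable_fun `[a, e] (speed c) /\ arc_length a e c = L%:E].
Proof.
elim=> [w a e ae|w1 w2 w3 L1 L2 s12 _ IH a e ae].
  have [arcw lenw] := C1_arc_cst a e w; have cw := C1_arc_speed_continuous arcw.
  exists (cst w); split; [|by []|by []|]; last first.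
    by split; [exact: subspace_continuous_measurable_fun|exact: lenw].
  split; first exact: C1_arc_continuous arcw.
  exists 1%N, (fun i => if i is 0%N then a else e); split=> // -[|//] _ /=.
  by split=> //; exists (cst w).
have [h ah he] : exists2 h, a < h & h < e.
  by exists ((a + e) / 2); [lra|lra].
have [b [arcb ba bh lenb]] := seg_param ah s12.
have [d [[cd [n [s [s0 sn sP]]]] dh de [md lend]]] := IH h e he.
pose c t := if t <= h then b t else d t.
have cb t : a <= t <= h -> c t = b t by rewrite /c => /andP[_ ->].
have cd' t : h <= t <= e -> c t = d t.
  move=> /andP[]; rewrite /c le_eqVlt => /predU1P[<- _|ht _].
    by rewrite lexx bh dh.
  by rewrite leNgt ht.
have [mb lencb] := arc_length_eq arcb cb.
have speed_cd t : h < t < e -> speed c t = speed d t.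
  move=> /andP[ht te]; apply: speed_near; near=> u; apply: cd'.
  by apply/andP; split; apply: ltW; near: u; [exact: lt_nbhsr|exact: lt_nbhsl].
have [mcd lencd] := eq_integral_itv speed_cd md.
have [mc E] := integral_itv_cat (ltW ah) (ltW he) (speed_ge0 c) mb mcd.
exists c; split; last first.
- split; first exact: mc.
  by rewrite {1}/arc_length E lencd -!/(arc_length _ _ _) lencb lenb lend.
- have hee : h <= e <= e by rewrite lexx andbT (ltW he).
  by rewrite (cd' _ hee); exact: de.
- have aah : a <= a <= h by rewrite lexx (ltW ah).
  by rewrite (cb _ aah); exact: ba.
split.
  rewrite (itv_cc_cat (ltW ah) (ltW he)).
  apply: withinU_continuous; [exact: itv_closed|exact: itv_closed|..].
    apply: subspace_eq_continuous (C1_arc_continuous arcb) => t.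
    by rewrite inE/= in_itv/= => /cb.
  apply: subspace_eq_continuous cd => t.
  by rewrite inE/= in_itv/= => /cd'.
exists n.+1, (fun i => if i is j.+1 then s j else a).
split; [by []|exact: sn|].
case=> [_|i].
  by rewrite s0; split; [exact: ah|exists b; [exact: arcb|exact: cb]].
rewrite ltnS => ltin; have [sii [bi arcbi dbi]] := sP i ltin.
split; first exact: sii.
exists bi; first exact: arcbi.
move=> t tss; rewrite -(dbi t tss); apply: cd'.
have s_lt j : (j < n)%N -> s j < s j.+1 by move=> /sP[].
move: tss => /andP[st ts]; apply/andP; split.
  rewrite -s0; apply: le_trans st.
  exact: (subdivision_le s_lt (ltnW ltin : (0 <= i <= n)%N)).
rewrite -sn; apply: (le_trans ts); apply: (subdivision_le s_lt).
by rewrite ltin leqnn.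
Unshelve. all: by end_near. Qed.

(** This converts every later statement on the distance into one on chains, which
can be concatenated, reversed, projected and lifted. *)
Lemma rdist_ltP x y (r : R) :
  (rdist x y < r%:E)%E <-> exists2 L, chain x y L & L < r.
Proof.
split=> [/ereal_inf_lt[_ [c [/piecewise_C1E pc c0 c1] <-]]|[L xyL Lr]].
  have [L] := piecewise_C1_chain pc; rewrite c0 c1 => cL lenL ltr.
  by exists L => //; rewrite -lte_fin -lenL.
have [c [pc c0 c1 [_ lenc]]] := chain_piecewise_C1 xyL ltr01.
apply: le_lt_trans (_ : L%:E < r%:E)%E; last by rewrite lte_fin.
apply: ereal_inf_lbound; exists c; last exact: lenc.
by split => //; exact/piecewise_C1E.
Qed.

End distance.

(** * Balls are open *)

Lemma derive_line (R : realType) (V : normedModType R) (v w : V) (t : R) :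
  derivable (fun u : R => u *: v + w) t 1 /\
  derive1 (fun u : R => u *: v + w) t = v.
Proof.
have -> : (fun u : R => u *: v + w) = (fun u : R => u *: v) + cst w.
  exact/funext.
have d1 : differentiable (fun u : R => u *: v) t by exact: differentiableZl.
have dl : differentiable ((fun u : R => u *: v) + cst w) t.
  exact: differentiableD.
split; first exact/derivable1_diffP.
rewrite derive1E' // diffD// diff_cst/= (@diffZl _ _ _ id)//.
by rewrite diff_val addr0 scale1r.
Qed.

Section balls.
Variables (R : realType) (m : nat) (M : riemannian_manifold R m).
Implicit Types (x y z : M) (phi : chart R m M).

(** The metric is small on small vectors, uniformly near a point, by joint
continuity of the quadratic form at the zero vector. *)
Lemma metric_near0 phi x (e : R) : atlas phi -> chart_dom phi x -> 0 < e ->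
  exists2 d : R, 0 < d & forall y v : 'rV[R]_m, `|phi x - y| < d -> `|v| < d ->
    chart_img phi y /\ qform (metric phi y) v < e ^+ 2.
Proof.
move=> aphi xphi e0; have yphi : chart_img phi (phi x) by exists x.
pose F := filter_prod (nbhs (phi x)) (nbhs (0 : 'rV[R]_m)).
have cmetric : metric phi z.1 @[z --> F] -->
    metric phi (phi x).
  have c2 := metric_continuous aphi yphi.
  by move=> A /c2 cA; exact: (@cvg_fst _ _ (nbhs (phi x)) _ _ _ cA).
have cq : qform (metric phi z.1) z.2 @[z --> F] -->
    qform (metric phi (phi x)) 0.
  by apply: cvg_qform; [exact: cmetric|exact: cvg_snd].
have q0 : qform (metric phi (phi x)) 0 < e ^+ 2.
  by rewrite /qform !mul0mx mxE exprn_gt0.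
have [/= [A B] [/nbhs_normP[d1/= d1_gt0 Ad1] /nbhs_normP[d2/= d2_gt0 Bd2]] AB] :
    F [set z | qform (metric phi z.1) z.2 < e ^+ 2].
  by apply: (cq [set r | r < e ^+ 2]); exact: lt_nbhsl.
have /nbhs_normP[d3/= d3_gt0 Cd3] : nbhs (phi x) (chart_img phi).
  by apply: open_nbhs_nbhs; split => //; exact: open_chart_img.
exists (Num.min d1 (Num.min d2 d3)); first by rewrite !lt_min d1_gt0 d2_gt0.
move=> y v; rewrite !lt_min => /and3P[yd1 _ yd3] /and3P[_ vd2 _].
split; first exact: Cd3.
apply: (AB (y, v)); split; first exact: Ad1.
by apply: Bd2; rewrite /= sub0r normrN.
Qed.

(** Nearby points are joined by short segments: the straight ones of a chart. *)
Lemma near_chain x (e : R) : 0 < e ->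
  \forall y \near x, exists2 L, chain x y L & L <= e.
Proof.
move=> e0; have [phi aphi xphi] := atlas_cover x.
have [d d0 small] := metric_near0 aphi xphi e0.
have near_dom : \forall y \near x, chart_dom phi y by exact: chart_dom_nbhs.
have near_d : \forall y \near x, `|phi x - phi y| < d.
  by apply: cvgr_dist_lt d0; exact: chart_continuous.
near=> y.
have yphi : chart_dom phi y by near: y.
have yd : `|phi x - phi y| < d by near: y.
pose v := phi y - phi x; pose l (t : R) : 'rV[R]_m := t *: v + phi x.
have vd : `|v| < d by rewrite distrC.
have cl : continuous l.
  by move=> t; apply: cvgD; [apply: cvgZ; [exact: cvg_id|exact: cvg_cst]|exact: cvg_cst].
pose I := [set t : R | `|phi x - l t| < d].
have oI : open I.
  apply: (@open_comp _ _ (fun t => `|phi x - l t|) [set r | r < d]).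
    by move=> t _; apply: cvg_norm; apply: cvgB; [exact: cvg_cst|exact: cl].
  exact: open_lt.
have aeI : `[0, 1] `<=` I.
  move=> t /=; rewrite in_itv/= => /andP[t0 t1].
  rewrite /I/= /l opprD addrC subrK normrN normrZ ger0_norm//.
  by rewrite (le_lt_trans _ vd)// ler_piMl.
have img t : I t -> chart_img phi (l t).
  by move=> It; have [] := small _ 0 It; rewrite ?normr0.
pose b := chart_inv phi \o l.
have cb t : I t -> {for t, continuous b}.
  move=> It; apply: continuous_comp; first exact: cl.
  exact: chart_inv_continuous (img t It).
have bE t : I t -> {near t, l =1 phi \o b}.
  move=> It; have : \forall u \near t, I u by apply: open_nbhs_nbhs; split.
  by apply: filterS => u Iu; rewrite /b/= chart_invK//; exact: img.
have db t : I t -> derivable (phi \o b) t 1 /\ derive1 (phi \o b) t = v.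
  move=> /bE lb; have [dl lE] := derive_line v (phi x) t.
  split; first exact: near_eq_derivable lb dl.
  by rewrite derive1E -(near_eq_derive _ lb) -derive1E.
have bdom t : I t -> chart_dom phi (b t).
  by move=> It; exact: chart_inv_dom (img t It).
have C1b : C1_on I b.
  apply: (C1_onP oI cb) => t It; exists phi.
  have near_I : \forall u \near t, I u by apply: open_nbhs_nbhs; split.
  split; [exact: aphi|exact: bdom|..].
    by apply: filterS near_I => u /db[].
  rewrite /prop_for /continuous_at (proj2 (db t It)).
  have vt : cst v u @[u --> t] --> v by exact: cvg_cst.
  apply: cvg_trans vt; apply: near_eq_cvg; near=> u.
  have Iu : I u by near: u.
  by rewrite (proj2 (db u Iu)).
have arcb : C1_arc 0 1 b by exists I; split; [exact: oI|exact: aeI|exact: C1b].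
have [L lenL] := C1_arc_length_fin arcb.
have speed_le t : I t -> speed b t <= e.
  move=> It; have [dbt bt] := db t It.
  rewrite (speedE aphi (cb t It) (bdom t It) dbt) bt.
  have [_ /ltW qe] := small _ v It vd.
  rewrite -(ger0_norm (ltW e0)) -sqrtr_sqr ler_wsqrtr//.
  by rewrite /b/= chart_invK//; exact: img.
have b0 : b 0 = x by rewrite /b/= /l scale0r add0r chart_funK.
have b1 : b 1 = y by rewrite /b/= /l scale1r subrK chart_funK.
exists L.
  apply: chain_seg; exists 0, 1, b.
  by split; [exact: ltr01|exact: arcb|exact: b0|exact: b1|exact: lenL].
rewrite -lee_fin -lenL /arc_length.
apply: (@le_trans _ _ (\int[lebesgue_measure]_(t in `[0%R, 1%R]) cst e%:E t)%E).
  apply: ge0_le_integral => //.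
  - by move=> t _; rewrite lee_fin speed_ge0.
  - apply/measurable_EFinP; apply: subspace_continuous_measurable_fun => //.
    exact: C1_arc_speed_continuous arcb.
  - by move=> t /aeI/speed_le; rewrite lee_fin.
rewrite integral_cst//= lebesgue_measure_itv/= lte_fin ltr01.
by rewrite oppr0 adde0 mule1.
Unshelve. all: by end_near. Qed.

(** A point of the ball is reached by a chain shorter than [r]; half of the spare
length is enough to reach all nearby points. *)
Lemma rball_open x (r : R) : open (rball x r).
Proof.
rewrite openE => y /rdist_ltP[L xyL Lr].
have e0 : 0 < (r - L) / 2 by rewrite divr_gt0// subr_gt0.
apply: filterS (near_chain y e0) => z [K yzK Ke].
apply/rdist_ltP; exists (L + K); first exact: chain_cat yzK.
by lra.
Qed.

End balls.

(** * Coverings and path lifting *)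

Section coverings.
Variables (X Y : topologicalType) (p : X -> Y).
Implicit Types (x : X) (y : Y).

(** A sheet over [U] bundled with the inverse [q] of the covering map, as a total
function whose values outside [U] are irrelevant. *)
Definition sheet (V : set X) (U : set Y) (q : Y -> X) :=
  [/\ open V /\ open U,
      forall x, V x -> U (p x) /\ q (p x) = x,
      forall y, U y -> V (q y) /\ p (q y) = y &
      forall y, U y -> {for y, continuous q}].

Lemma covering_sheet y : covering p -> exists U, [/\ open U, U y &
  forall x, U (p x) -> exists V q, V x /\ sheet V U q].
Proof.
move=> [cp _ /(_ y)[U [oU Uy [S [oS _ Scover SU]]]]].
exists U; split=> // x Upx.
have [V SV Vx] : (\bigcup_(V in S) V) x by rewrite Scover.
have [[VU Vinj Vsurj] _ [q cq qp]] := SU V SV.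
exists V, q; split=> //; split; first by split; [exact: oS|].
- by move=> z Vz; split; [exact: VU|exact: qp].
- by move=> z /Vsurj[w Vw <-]; rewrite (qp w Vw).
- by move=> z Uz; move: cq; rewrite continuous_open_subspace//; apply; exact: mem_set.
Qed.

End coverings.

Section unique_lifting.
Variables (X Y : topologicalType) (p : X -> Y).

(** Two lifts that agree at a point stay in a common sheet nearby, where the
projection determines them. *)
Lemma sheet_near_eq (Z : topologicalType) (f g : Z -> X) z : covering p ->
  {for z, continuous f} -> {for z, continuous g} ->
  (\forall w \near z, p (f w) = p (g w)) -> f z = g z ->
  \forall w \near z, f w = g w.
Proof.
move=> hp cf cg pfg fgz.
have [U [oU Upfz /(_ _ Upfz)[V [q [Vfz [[oV _] VU _ _]]]]]] :=
  covering_sheet (p (f z)) hp.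
have nV : nbhs (f z) V by apply: open_nbhs_nbhs; split.
have fV : \forall w \near z, V (f w) by exact: cf.
have gV : \forall w \near z, V (g w) by apply: cg; rewrite -fgz.
near=> w.
have [_ <-] : U (p (f w)) /\ q (p (f w)) = f w by apply: VU; near: w.
have [_ <-] : U (p (g w)) /\ q (p (g w)) = g w by apply: VU; near: w.
by congr q; near: w.
Unshelve. all: by end_near. Qed.

(** The set where two lifts agree is open by [sheet_near_eq] and closed because
the total space is Hausdorff. *)
Lemma unique_lift (Z : topologicalType) (f g : Z -> X) z0 : covering p ->
  hausdorff_space X -> connected [set: Z] -> continuous f -> continuous g ->
  p \o f = p \o g -> f z0 = g z0 -> f = g.
Proof.
move=> hp hX cZ cf cg pfg fg0.
suff E : [set z | f z = g z] = setT.
  by apply/funext => z; have : [set: Z] z by []; rewrite -E.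
apply: cZ; first by exists z0.
- exists [set z | f z = g z]; last by rewrite setTI.
  rewrite openE => z /= fgz.
  apply: sheet_near_eq => //; [exact: cf|exact: cg|].
  by near=> w; exact: (congr1 (fun k => k w) pfg).
- exists [set z | f z = g z]; last by rewrite setTI.
  rewrite -[X in closed X]setCK; apply: open_closedC.
  rewrite openE => z /= /eqP fgz.
  move: hX; rewrite open_hausdorff => /(_ _ _ fgz).
  move=> [[A B] /= [/set_mem Af /set_mem Bg] [oA oB /eqP/seteqP[AB _]]].
  have fA : \forall w \near z, A (f w) by apply: cf; apply: open_nbhs_nbhs.
  have gB : \forall w \near z, B (g w) by apply: cg; apply: open_nbhs_nbhs.
  near=> w => fgw; apply: (AB (f w)); split; first by near: w.
  by rewrite fgw; near: w.
Unshelve. all: by end_near. Qed.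

End unique_lifting.

Section path_lifting.
Variables (R : realType) (X Y : topologicalType) (p : X -> Y).
Variables (I : set R) (b : R -> Y).
Hypotheses (hp : covering p) (oI : open I).
Hypothesis cb : forall t, I t -> {for t, continuous b}.

(** [J] is open so that a lift of a C^1 arc is again a C^1 arc, with derivatives
at the end points. *)
Definition lift_on (J : set R) (c : R -> X) :=
  [/\ open J, J `<=` I & forall t, J t -> {for t, continuous c} /\ p (c t) = b t].

Definition liftable x (a t : R) :=
  exists J c, [/\ lift_on J c, `[a, t] `<=` J & c a = x].

Lemma lift_section (V : set X) (U : set Y) q (J : set R) : sheet p V U q ->
  open J -> J `<=` I -> (forall t, J t -> U (b t)) -> lift_on J (q \o b).
Proof.
move=> [_ _ pqE cq] oJ JI JU; split=> // t Jt; split.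
  by apply: continuous_comp; [exact/cb/JI|exact/cq/JU].
by have [] := pqE (b t) (JU t Jt).
Qed.

(** Near every parameter value a lift can be prolonged through a sheet. The
prolongation agrees with the given lift around the gluing point, since both
stay in the same sheet there. *)
Lemma liftable_extend x (a t : R) : I t -> exists2 d : R, 0 < d &
  forall s s', a <= s <= s' -> `|t - s| < d -> `|t - s'| < d ->
    liftable x a s -> liftable x a s'.
Proof.
move=> It.
have oball (u r : R) : open [set v : R | `|u - v| < r].
  by rewrite -[X in open X]/(ball_ Num.norm u r) ball_normE; exact: ball_open.
have [U [oU Ubt Ucover]] := covering_sheet (b t) hp.
have /nbhs_normP[d/= d0 tdIU] : \forall u \near t, I u /\ U (b u).
  apply: filterI; first by apply: open_nbhs_nbhs.
  by apply: cb => //; apply: open_nbhs_nbhs.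
exists d => // s s' /andP[as_ ss'] tsd tsd' [J [c [[oJ JI cJ] asJ ca]]].
have Js : J s by apply: asJ; rewrite /= in_itv/= as_ lexx.
have [csc pcs] := cJ s Js.
have [V [q [Vcs sVU]]] : exists V q, V (c s) /\ sheet p V U q.
  by apply: Ucover; rewrite pcs; have [] := tdIU s tsd.
have [[oV _] VU _ _] := sVU.
have /nbhs_normP[e/= e0 seJ] : \forall u \near s, [/\ J u, V (c u) & `|t - u| < d].
  have n1 : \forall u \near s, J u by apply: open_nbhs_nbhs.
  have n2 : \forall u \near s, V (c u).
    by apply: csc; apply: open_nbhs_nbhs.
  have n3 : \forall u \near s, `|t - u| < d.
    by apply: open_nbhs_nbhs; split=> //; exact: oball.
  by near=> u; split; near: u.
(* the two branches of c' agree on a neighbourhood J2 of the gluing point *)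
pose c' u := if u <= s then c u else q (b u).
pose J1 := J `&` [set u | u < s].
pose J2 := [set u : R | `|s - u| < e].
pose J3 := [set u : R | `|t - u| < d] `&` [set u | s < u].
have oJ1 : open J1 by apply: openI => //; exact: open_lt.
have oJ2 : open J2 by exact: oball.
have oJ3 : open J3 by apply: openI; [exact: oball|exact: open_gt].
have l1 : lift_on J1 c by split=> // [u [/JI]|u [/cJ]].
have l23 : lift_on (J2 `|` J3) (q \o b).
  apply: lift_section sVU _ _ _; first exact: openU.
    by move=> u [/seJ[/JI]|[/tdIU[]]].
  by move=> u [/seJ[_ _ /tdIU[]]|[/tdIU[]]].
have E1 u : J1 u -> c u = c' u by move=> [_ /ltW us]; rewrite /c' us.
have E23 u : (J2 `|` J3) u -> q (b u) = c' u.
  rewrite /c'; case: ltP => // us [/seJ[Ju Vcu _]|[_ /=]].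
    by have [_ <-] := cJ u Ju; have [_ ->] := VU _ Vcu.
  by rewrite ltNge us.
have lift_eq K f : (forall u, K u -> f u = c' u) -> lift_on K f -> lift_on K c'.
  move=> fc [oK KI fK]; split=> // u Ku; have [cfu pfu] := fK u Ku.
  split; last by rewrite -fc.
  rewrite /prop_for /continuous_at -fc//; apply: cvg_trans cfu.
  apply: near_eq_cvg; have : \forall v \near u, K v by apply: open_nbhs_nbhs.
  by apply: filterS => v /fc.
have [_ J1I c1] := lift_eq _ _ E1 l1; have [_ J23I c23] := lift_eq _ _ E23 l23.
exists (J1 `|` (J2 `|` J3)), c'; split; first split.
- by apply: openU => //; exact: openU.
- by move=> u [/J1I|/J23I].
- by move=> u [/c1|/c23].
- move=> u /=; rewrite in_itv/= => /andP[au us'].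
  have [us|su|->] := ltgtP u s.
  + by left; split=> //; apply: asJ; rewrite /= in_itv/= au ltW.
  + right; right; split=> //=; move: tsd tsd'; rewrite !ltr_norml.
    move=> /andP[? ?] /andP[? ?]; apply/andP; split; lra.
  + by right; left; rewrite /J2/= subrr normr0.
- by rewrite /c' as_.
Unshelve. all: by end_near. Qed.

(** The parameters up to which the path lifts have a supremum; by
[liftable_extend] it is attained, and it cannot be smaller than [e]. *)
Lemma path_lift x (a e : R) : a <= e -> `[a, e] `<=` I -> p x = b a ->
  liftable x a e.
Proof.
move=> ae aeI pxa.
have Ia : I a by apply: aeI; rewrite /= in_itv/= lexx.
have l0 : liftable x a a.
  have [U [oU Uba Ucover]] := covering_sheet (b a) hp.
  have [|V [q [Vx sVU]]] := Ucover x; first by rewrite pxa.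
  have [_ VU _ _] := sVU.
  have : nbhs a [set u | I u /\ U (b u)].
    apply: filterI; first by apply: open_nbhs_nbhs.
    by apply: cb => //; apply: open_nbhs_nbhs.
  rewrite nbhsE => -[J [oJ Ja] JIU].
  exists J, (q \o b); split.
  - by apply: lift_section sVU _ _ _ => // u /JIU[].
  - by rewrite set_itv1 => u ->.
  - by rewrite /= -pxa; have [_ ->] := VU x Vx.
pose S := [set t : R | a <= t <= e /\ liftable x a t].
have Sa : S a by split=> //; rewrite lexx.
have hS : has_sup S.
  by split; [exists a|exists e => t [/andP[]]].
pose T := sup S.
have aT : a <= T by apply: ub_le_sup => //; exact: hS.2.
have Te : T <= e by apply: ge_sup; [exists a|move=> t [/andP[]]].
have [d d0 ext] : exists2 d : R, 0 < d &
    forall s s', a <= s <= s' -> `|T - s| < d -> `|T - s'| < d ->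
      liftable x a s -> liftable x a s'.
  by apply: liftable_extend; apply: aeI; rewrite /= in_itv/= aT.
have [s [/andP[as_ se] ls] sT] := sup_adherent d0 hS.
have sleT : s <= T.
  by apply: ub_le_sup; [exact: hS.2|split=> //; rewrite as_].
have Tsd : `|T - s| < d by rewrite ger0_norm ?subr_ge0//; move: sT; rewrite -/T; lra.
(* a parameter beyond the supremum, unless the supremum is already e *)
pose s' := Num.min e (T + d / 2).
have Ts' : T <= s' by rewrite le_min Te/=; lra.
have s'd : `|T - s'| < d.
  rewrite distrC ger0_norm ?subr_ge0//.
  have : s' <= T + d / 2 by rewrite ge_min lexx orbT.
  by lra.
have ls' : liftable x a s'.
  by apply: ext ls => //; rewrite as_ (le_trans sleT).
have s'T : s' <= T.
  apply: ub_le_sup; first exact: hS.2.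
  by split=> //; rewrite (le_trans aT Ts')/= ge_min lexx.
suff <- : s' = e by [].
rewrite /s' min_l// leNgt; apply/negP => /ltW Td.
by move: s'T; rewrite /s' min_r// gerDl leNgt divr_gt0.
Qed.

End path_lifting.

(** * Riemannian coverings *)

Section pulled_chart.
Variables (R : realType) (m : nat) (X Y : topologicalType) (p : X -> Y).
Variables (V : set X) (U : set Y) (q : Y -> X) (phi : chart R m Y).
Hypotheses (cp : continuous p) (sVU : sheet p V U q).

Let D := V `&` p @^-1` chart_dom phi.

Let image_D : (phi \o p) @` D = phi @` (U `&` chart_dom phi).
Proof.
have [_ VU UV _] := sVU; apply/seteqP; split => _ [z [z1 z2] <-].
  by exists (p z) => //; split=> //; have [] := VU z z1.
by have [Vqz pqz] := UV z z1; exists (q z); rewrite /D /= ?pqz.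
Qed.

Let open_D : open D.
Proof.
have [[oV _] _ _ _] := sVU; apply: openI => //.
by apply: open_comp => [z _|]; [exact: cp|exact: open_chart_dom].
Qed.

Let open_image : open ((phi \o p) @` D).
Proof.
have [[_ oU] _ _ _] := sVU; rewrite image_D openE => _ [z [Uz zphi] <-].
have img_z : chart_img phi (phi z) by exists z.
have n1 : \forall y \near phi z, chart_img phi y.
  by apply: open_nbhs_nbhs; split=> //; exact: open_chart_img.
have n2 : \forall y \near phi z, (U `&` chart_dom phi) (chart_inv phi y).
  apply: (chart_inv_continuous img_z); rewrite chart_funK//.
  apply: open_nbhs_nbhs; split=> //; apply: openI => //; exact: open_chart_dom.
near=> y.
have [w wphi wy] : chart_img phi y by near: y.
have : (U `&` chart_dom phi) (chart_inv phi y) by near: y.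
rewrite -wy chart_funK// => wU; by exists w.
Unshelve. all: by end_near. Qed.

Let funK x : D x -> (q \o chart_inv phi) ((phi \o p) x) = x.
Proof.
by have [_ VU _ _] := sVU; move=> [Vx px]/=; rewrite chart_funK//; have [] := VU x Vx.
Qed.

Let continuous_fun : {within D, continuous (phi \o p)}.
Proof.
rewrite continuous_open_subspace// => x /set_mem[_ px].
by apply: continuous_comp; [exact: cp|exact: chart_continuous].
Qed.

Let continuous_inv : {within (phi \o p) @` D, continuous (q \o chart_inv phi)}.
Proof.
have [_ _ _ cq] := sVU.
rewrite continuous_open_subspace// => y /set_mem; rewrite image_D.
move=> [z [Uz zphi] <-]; apply: continuous_comp.
  by apply: chart_inv_continuous; exists z.
by apply: cq; rewrite chart_funK.
Qed.

(** These are the charts that [pulled_back_metric] speaks about; the sheet makes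
[phi \o p] injective on its domain. *)
Definition pulled_chart : chart R m X :=
  Chart open_D open_image funK continuous_fun continuous_inv.

End pulled_chart.

Section local_isometry.
Variables (R : realType) (m : nat) (N Nb : riemannian_manifold R m).
Variable p : Nb -> N.
Hypotheses (hp : covering p) (hmetric : pulled_back_metric p).

Let cp : continuous p. Proof. by case: hp. Qed.

(** In such charts [p] reads as the identity and the two metrics have the same
coefficients; this is the form in which [p] is a local isometry. *)
Lemma adapted_chart (phi : chart R m N) (x : Nb) :
  atlas phi -> chart_dom phi (p x) ->
  exists V U q (sVU : sheet p V U q), let psi := pulled_chart phi cp sVU in
    [/\ chart_dom psi x, atlas psi &
        forall y, chart_img psi y -> metric psi y = metric phi y].
Proof.
move=> aphi xphi.
have [U [oU Upx /(_ _ Upx)[V [q [Vx sVU]]]]] := covering_sheet (p x) hp.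
exists V, U, q, sVU => psi.
have [|//|apsi Epsi] := @hmetric phi psi aphi; first by move=> z [].
by split.
Qed.

Lemma C1_on_project (I : set R) (c : R -> Nb) : open I -> C1_on I c ->
  C1_on I (p \o c).
Proof.
move=> oI C1; have [cc dc] := C1; split=> [t It|phi t aphi It tphi].
  by apply: continuous_comp; [exact: cc|exact: cp].
have [V [U [q [sVU [tpsi apsi _]]]]] := adapted_chart aphi tphi.
exact: dc apsi It tpsi.
Qed.

(** In the charts [phi \o p], the coordinates of [c] are those of [p \o c]. *)
Lemma C1_on_lift (I : set R) (c : R -> Nb) : open I ->
  (forall t, I t -> {for t, continuous c}) -> C1_on I (p \o c) -> C1_on I c.
Proof.
move=> oI cc C1; have [cpc dpc] := C1; apply: (C1_onP oI cc) => t It.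
have [phi aphi tphi] := atlas_cover (p (c t)).
have [V [U [q [sVU [tpsi apsi _]]]]] := adapted_chart aphi tphi.
exists (pulled_chart phi cp sVU); split; [exact: apsi|exact: tpsi|..].
  exact: (C1_on_near_derivable oI C1 aphi It tphi).
by have [_] := dpc phi t aphi It tphi.
Qed.

Lemma speed_project (I : set R) (c : R -> Nb) t : C1_on I c -> I t ->
  speed (p \o c) t = speed c t.
Proof.
move=> [cc dc] It.
have [phi aphi tphi] := atlas_cover (p (c t)).
have [V [U [q [sVU [tpsi apsi Epsi]]]]] := adapted_chart aphi tphi.
have [dt _] := dc _ t apsi It tpsi.
rewrite (speedE apsi (cc t It) tpsi dt) (speedE aphi (c := p \o c) _ tphi dt).
  by rewrite Epsi//; exists (c t).
by apply: continuous_comp; [exact: cc|exact: cp].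
Qed.

Lemma C1_arc_project (a e : R) (c : R -> Nb) : C1_arc a e c ->
  C1_arc a e (p \o c) /\ arc_length a e (p \o c) = arc_length a e c.
Proof.
move=> [I [oI aeI C1]]; split.
  by exists I; split; [exact: oI|exact: aeI|exact: C1_on_project].
apply: eq_integral => t /set_mem/aeI It.
by rewrite (speed_project C1 It).
Qed.

Lemma seg_project x y (L : R) : seg x y L -> seg (p x) (p y) L.
Proof.
move=> [a [e [b [ae arcb <- <- lenb]]]].
have [arcpb lenpb] := C1_arc_project arcb.
by exists a, e, (p \o b); split; [exact: ae|exact: arcpb| | |rewrite lenpb].
Qed.

Lemma chain_project x y (L : R) : chain x y L -> chain (p x) (p y) L.
Proof.
elim=> [z|z1 z2 z3 L1 L2 s12 _ IH]; first exact: chain_nil.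
by apply: chain_cons IH; exact: seg_project.
Qed.

(** A lift of a C^1 arc is a C^1 arc of the same length, as [p] preserves
speeds. *)
Lemma seg_lift x y (L : R) : seg (p x) y L ->
  exists2 z, p z = y & seg x z L.
Proof.
move=> [a [e [b [ae [I [oI aeI C1]] ba be lenb]]]]; have [cb _] := C1.
have [J [c [[oJ JI cJ] aeJ ca]]] := path_lift hp oI cb (ltW ae) aeI (esym ba).
have Je : J e by apply: aeJ; rewrite /= in_itv/= lexx (ltW ae).
have near_pc t : J t -> {near t, p \o c =1 b}.
  move=> Jt; have : \forall u \near t, J u by apply: open_nbhs_nbhs; split.
  by apply: filterS => u /cJ[].
have C1pc : C1_on J (p \o c).
  split=> [t Jt|phi t aphi Jt tphi].
    by apply: continuous_comp; [have [] := cJ t Jt|exact: cp].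
  have [_ Et] := cJ t Jt; rewrite /= Et in tphi.
  have [db cdb] := C1.2 phi t aphi (JI _ Jt) tphi.
  have near_phi u : J u -> {near u, phi \o b =1 phi \o (p \o c)}.
    by move=> /near_pc; apply: filterS => v /= ->.
  split; first exact: near_eq_derivable (near_phi t Jt) db.
  have E u : J u -> derive1 (phi \o b) u = derive1 (phi \o (p \o c)) u.
    by move=> Ju; rewrite !derive1E; exact: near_eq_derive (near_phi u Ju).
  rewrite /prop_for /continuous_at -(E t Jt); apply: cvg_trans cdb.
  apply: near_eq_cvg; have : \forall u \near t, J u by apply: open_nbhs_nbhs; split.
  by apply: filterS => u /E.
have C1c : C1_on J c.
  by apply: C1_on_lift oJ _ C1pc => t /cJ[].
exists (c e); first by have [_ ->] := cJ e Je.
exists a, e, c; split; [exact: ae| |exact: ca|by []|].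
  by exists J; split; [exact: oJ|exact: aeJ|exact: C1c].
rewrite -lenb; apply: eq_integral => t /set_mem/aeJ Jt.
by rewrite -(speed_project C1c Jt) (speed_near (near_pc t Jt)).
Qed.

Lemma chain_lift x y (L : R) : chain (p x) y L ->
  exists2 z, p z = y & chain x z L.
Proof.
move E : (p x) => px cL; elim: cL x E => [z x <-|z1 z2 z3 L1 L2 s12 _ IH x E].
  by exists x => //; exact: chain_nil.
rewrite -E in s12; have [z pz xz] := seg_lift s12.
have [w pw zw] := IH z pz.
by exists w => //; exact: chain_cons xz zw.
Qed.

(** Deck transformations are isometries: a curve and its image under a deck
transformation have the same projection, hence the same length. *)
Lemma chain_deck g x y (L : R) : deck p g -> chain x y L -> chain (g x) (g y) L.
Proof.
move=> [cg pg _]; elim=> [z|z1 z2 z3 L1 L2 s12 _ IH]; first exact: chain_nil.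
apply: chain_cons IH; have [a [e [b [ae [I [oI aeI C1]] <- <- lenb]]]] := s12.
have pgb : p \o (g \o b) = p \o b by rewrite compA pg.
have C1gb : C1_on I (g \o b).
  apply: (C1_on_lift oI); last by rewrite pgb; exact: C1_on_project.
  by move=> t It; apply: continuous_comp; [exact: C1.1|exact: cg].
exists a, e, (g \o b); split; [exact: ae| |by []|by []|].
  by exists I; split; [exact: oI|exact: aeI|exact: C1gb].
rewrite -lenb; apply: eq_integral => t /set_mem/aeI It.
by rewrite -(speed_project C1gb It) pgb (speed_project C1 It).
Qed.

(** Two deck transformations are lifts of [p] through itself. *)
Lemma deck_eq g h x : deck p g -> deck p h -> g x = h x -> g = h.
Proof.
move=> [cg pg _] [ch ph _]; apply: (unique_lift hp) => //.
- exact: manifold_hausdorff.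
- exact: manifold_connected.
- by rewrite pg ph.
Qed.

Lemma rball_project x (r : R) y : rball x r y -> rball (p x) r (p y).
Proof.
by move=> /rdist_ltP[L xyL Lr]; apply/rdist_ltP; exists L => //; exact: chain_project.
Qed.

Lemma rball_lift x (r : R) y : rball (p x) r y ->
  exists2 z, p z = y & rball x r z.
Proof.
move=> /rdist_ltP[L /chain_lift[z pz xzL] Lr].
by exists z => //; apply/rdist_ltP; exists L.
Qed.

(** The chain from [x] to [g y] is continued to [g x] by the image under [g] of
the reversed chain from [y] to [x]. *)
Lemma deck_disp_rball g x (r : R) y :
  deck p g -> rball x r y -> rball x r (g y) ->
  deck_disp p x (2 * r) g.
Proof.
move=> gG /rdist_ltP[L xyL Lr] /rdist_ltP[K xgyK Kr]; split=> //; apply: ltW.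
apply/rdist_ltP; exists (K + L); last by lra.
by apply: chain_cat xgyK _; apply: chain_deck => //; exact: chain_sym.
Qed.

(** The displacement of [x] is only an infimum, but [y] lies strictly inside the
ball: the spare length [r - L] pays for an almost minimal chain. *)
Lemma rball_deck_disp g x (r : R) y : deck_disp p x r g -> rball x r y ->
  rball x (2 * r) (g y).
Proof.
move=> [gG xgx] /rdist_ltP[L xyL Lr].
have /rdist_ltP[K xgxK Kr] : (rdist x (g x) < (r + (r - L))%:E)%E.
  by apply: le_lt_trans xgx _; rewrite lte_fin; lra.
apply/rdist_ltP; exists (K + L); last by lra.
by apply: chain_cat xgxK _; exact: chain_deck.
Qed.

End local_isometry.

(** * Volumes and fibres *)

Section counting.
Variable R : realType.

Lemma counting_le (T U : choiceType) (A : set T) (B : set U) :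
  (A #<= B)%card -> (counting A <= counting B :> \bar R)%E.
Proof.
move=> AB; rewrite /counting; case: (asboolP (finite_set B)) => finB; last first.
  by rewrite leey.
have finA := card_le_finite AB finB.
rewrite asboolT// lee_fin ler_nat.
have [n Bn] := finB.
have [Bn1 Bn2] : (B #<= `I_n)%card /\ (`I_n #<= B)%card.
  by apply/andP; rewrite -card_eq_le.
apply: leq_trans (leq_card_fset_set finB Bn2).
exact/geq_card_fset_set/(card_le_trans AB).
Qed.

(** Comparing cardinals through a relation leaves to a single use of choice the
selection of an injection. *)
Lemma counting_le_rel (T U : choiceType) (A : set T) (B : set U)
    (r : T -> U -> Prop) :
  (forall a, A a -> exists2 b, B b & r a b) ->
  (forall a a' b, A a -> A a' -> r a b -> r a' b -> a = a') ->
  (counting A <= counting B :> \bar R)%E.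
Proof.
move=> Ar rinj; have [->|/set0P[a0 Aa0]] := eqVneq A set0.
  by apply: counting_le; exact: card_ge0.
have [b0 _ _] := Ar a0 Aa0.
have [f fP] : {f : T -> U & forall a, A a -> B (f a) /\ r a (f a)}.
  apply: (@choice _ _ (fun a b => A a -> B b /\ r a b)) => a.
  by have [/Ar[b Bb rab]|nAa] := pselect (A a); [exists b|exists b0].
apply: counting_le; have finj : {in A &, injective f}.
  move=> a a' /set_mem Aa /set_mem Aa' faa'.
  have [_ ra] := fP a Aa; have [_] := fP a' Aa'; rewrite -faa'.
  exact: rinj Aa Aa' ra.
apply: (@card_le_trans _ _ _ (f @` A)).
  by have := inj_card_eq finj; rewrite card_eq_le => /andP[].
by apply: subset_card_le => _ [a Aa <-]; have [] := fP a Aa.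
Qed.

End counting.

Section covering_measure.
Variables (R : realType) (d d' : measure_display).
Variables (X : measurableType d) (Y : measurableType d').
Variables (nu : {measure set X -> \bar R}) (mu : {measure set Y -> \bar R}).
Variables (p : X -> Y) (A : nat -> set X).
Hypotheses (mA : forall i, measurable (A i)) (tA : trivIset setT A)
  (UA : \bigcup_i A i = setT).
Hypothesis mp : forall i (B : set X), measurable B -> B `<=` A i ->
  measurable (p @` B) /\ mu (p @` B) = nu B.

(** The area formula.  As [p] is injective on the pieces in the intended use, the
points of [E] above [y] correspond to the indices of the pieces they lie in; the
formula for [E] is the sum of those for [E `&` A i]. *)
Lemma measure_fiber_counting (E : set X) : measurable E ->
  measurable_fun setT
    (fun y => counting [set i | (p @` (E `&` A i)) y] : \bar R) /\
  nu E = (\int[mu]_y counting [set i | (p @` (E `&` A i)) y])%E.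
Proof.
move=> mE; pose P i := p @` (E `&` A i).
have mEA i : measurable (E `&` A i) by exact: measurableI.
have mP i : measurable (P i) by have [] := mp (mEA i) (@subIsetr _ _ _).
have nuP i : mu (P i) = nu (E `&` A i).
  by have [] := mp (mEA i) (@subIsetr _ _ _).
have countE : (fun y => counting [set i | P i y] : \bar R) =
    fun y => (\sum_(0 <= i <oo) (\1_(P i) y)%:E)%E.
  apply/funext => y; rewrite counting_dirac; apply: eq_eseriesr => i _.
  rewrite diracE indicE.
  suff -> : (i \in [set j | P j y]) = (y \in P i) by [].
  by apply/idP/idP => /set_mem Piy; exact/mem_set.
have mI i : measurable_fun setT (fun y => (\1_(P i) y)%:E : \bar R).
  by apply/measurable_EFinP; exact: measurable_indic.
rewrite countE; split.
  by apply: ge0_emeasurable_sum => // i y _ _; rewrite lee_fin.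
rewrite integral_nneseries//.
rewrite -[in LHS](setIT E) -UA setI_bigcupr measure_semi_bigcup//; last 2 first.
- exact: trivIset_setIl.
- exact: bigcup_measurable.
by apply: eq_eseriesr => i _; rewrite integral_indic// setIT -nuP.
Qed.

End covering_measure.

(** The Lindelof property, for open sets that are small in a prescribed sense. *)
Lemma second_countable_cover (X : topologicalType) (good : set X -> Prop) :
  @second_countable X -> good set0 ->
  (forall V W, V `<=` W -> good W -> good V) ->
  (forall x, exists W, [/\ open W, W x & good W]) ->
  exists F : nat -> set X,
    (forall n, open (F n) /\ good (F n)) /\ \bigcup_n F n = setT.
Proof.
move=> [B /countable_injP[f finj] [oB Bnbhs]] good0 goodS goodx.
pose F n := if pselect (exists2 b, B b /\ good b & f b = n) is left e
            then s2val (cid2 e) else set0.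
exists F; split=> [n|].
  rewrite /F; case: pselect => [e|_]; last by split; [exact: open0|].
  by case: cid2 => b [Bb gb] _ /=; split; [exact: oB|].
rewrite -subTset => x _; have [W [oW Wx gW]] := goodx x.
have [b [Bb bx] bW] := Bnbhs x W (open_nbhs_nbhs (conj oW Wx)).
exists (f b) => //; rewrite /F; case: pselect => [e|[]].
  case: cid2 => c [Bc _] /= fcb.
  by rewrite (finj c b) ?inE.
by exists b => //; split=> //; exact: goodS gW.
Qed.

Section volume.
Variables (R : realType) (m : nat) (N Nb : riemannian_manifold R m).
Variable p : Nb -> N.
Variables (vol : {measure set (borel N) -> \bar R})
  (volb : {measure set (borel Nb) -> \bar R}).
Hypotheses (hp : covering p) (hmetric : pulled_back_metric p)
  (hvol : is_riemannian_volume vol) (hvolb : is_riemannian_volume volb).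

Lemma borel_open (M : riemannian_manifold R m) (U : set M) :
  open U -> measurable (U : set (borel M)).
Proof. by move=> oU; exact: sub_sigma_algebra. Qed.

Lemma sheet_image_measurable (V : set Nb) (U : set N) q (A : set (borel Nb)) :
  sheet p V U q -> A `<=` V -> measurable A ->
  measurable (p @` A : set (borel N)).
Proof.
move=> [[_ oU] VU UV cq] AV mA.
have -> : p @` A = U `&` q @^-1` A.
  apply/seteqP; split=> [_ [x Ax <-]|y [Uy Aqy]].
    by have [Upx qpx] := VU x (AV x Ax); split=> //; rewrite /preimage/= qpx.
  by have [_ pqy] := UV y Uy; exists (q y).
have mq : measurable_fun (U : set (borel N)) (q : borel N -> borel Nb).
  apply: (measurability (@open Nb : set (set (borel Nb)))) => //.
  move=> _ [W oW <-].
  apply: borel_open; rewrite openE => y [Uy Wqy].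
  have nU : nbhs y U by apply: open_nbhs_nbhs.
  have nO : nbhs (q y) W by apply: open_nbhs_nbhs.
  by apply: filterI nU _; exact: cq Uy _ nO.
exact: mq (borel_open oU) _ mA.
Qed.

Lemma eq_lebesgue_int n (D : set 'rV[R]_n) (f g : 'rV[R]_n -> \bar R) :
  (forall y, D y -> f y = g y) -> lebesgue_int D f = lebesgue_int D g.
Proof. by move=> fg; apply: eq_integral => t /set_mem/fg. Qed.

Definition patch (W : set Nb) := {in W &, injective p} /\
  forall A : set (borel Nb), measurable A -> A `<=` W ->
    measurable (p @` A : set (borel N)) /\ vol (p @` A) = volb A.

(** In an adapted chart and in the chart it comes from, the two volumes are given
by the same integral. *)
Lemma patch_nbhs x : exists W, [/\ open W, W x & patch W].
Proof.
have [phi aphi xphi] := atlas_cover (p x).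
have [V [U [q [sVU [xpsi apsi Epsi]]]]] := adapted_chart hp hmetric aphi xphi.
set psi := pulled_chart _ _ _ in xpsi apsi Epsi.
have [_ VU _ _] := sVU.
exists (chart_dom psi); split; [exact: open_chart_dom|exact: xpsi|split].
  move=> y z /set_mem[Vy _] /set_mem[Vz _] pyz.
  by have [_ <-] := VU y Vy; have [_ <-] := VU z Vz; rewrite pyz.
move=> A mA Apsi.
have mpA : measurable (p @` A : set (borel N)).
  by apply: (sheet_image_measurable sVU _ mA) => y /Apsi[].
split=> //; rewrite (hvolb apsi mA Apsi) (hvol aphi mpA); last first.
  by move=> _ [y /Apsi[_ yphi] <-].
rewrite image_comp; apply: eq_lebesgue_int => _ [y Ay <-].
by rewrite Epsi//; exists y => //; exact: Apsi.
Qed.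

Lemma patch_partition : exists A : nat -> set (borel Nb),
  [/\ forall i, measurable (A i), trivIset setT A, \bigcup_i A i = setT &
      forall i, patch (A i)].
Proof.
have patchS V W : V `<=` W -> patch W -> patch V.
  move=> VW [Winj Wvol]; split.
    by move=> y z /set_mem/VW/mem_set + /set_mem/VW/mem_set; exact: Winj.
  by move=> A mA /subset_trans/(_ VW); exact: Wvol.
have [F [FP UF]] : exists F : nat -> set Nb,
    (forall n, open (F n) /\ patch (F n)) /\ \bigcup_n F n = setT.
  apply: second_countable_cover.
  - exact: manifold_second_countable.
  - by have [W [_ _ sW]] := patch_nbhs point; apply: patchS sW.
  - exact: patchS.
  - exact: patch_nbhs.
exists (seqDU F); split.
- by apply: seqDU_measurable => n; apply: borel_open; have [] := FP n.
- exact: trivIset_seqDU.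
- by rewrite -seqDU_bigcup_eq.
- by move=> i; apply: patchS (FP i).2; exact: subDsetl.
Qed.

End volume.

Theorem theorem4 (R : realType) (m : nat) (N Nb : riemannian_manifold R m)
    (p : Nb -> N) (x0 : N) (xb0 : Nb)
    (vol : {measure set (borel N) -> \bar R})
    (volb : {measure set (borel Nb) -> \bar R})
    (hN : rcomplete N)
    (hp : normal_covering p)
    (hmetric : pulled_back_metric p)
    (hx0 : p xb0 = x0)
    (hvol : is_riemannian_volume vol)
    (hvolb : is_riemannian_volume volb) :
  forall r : R, 0 < r ->
    (volb (rball xb0 r) <=
       counting (deck_disp p xb0 (2 * r)) * vol (rball x0 r))%E /\
    (counting (deck_disp p xb0 r) * vol (rball x0 r) <=
       volb (rball xb0 (2 * r)))%E.
Proof.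
move=> r _; have [cov normal] := hp.
have [A [mA tA UA patchA]] := patch_partition cov hmetric hvol hvolb.
have mball (M : riemannian_manifold R m) (x : M) (s : R) :
    measurable (rball x s : set (borel M)).
  by apply: borel_open; exact: rball_open.
pose fib (E : set Nb) y := [set i | (p @` (E `&` A i)) y].
have fibE s := measure_fiber_counting mA tA UA (fun i => (patchA i).2)
  (mball Nb xb0 s).
have countZ (k : \bar R) : (0 <= k -> k * vol (rball x0 r) =
    \int[vol]_y (k * (\1_(rball x0 r) y)%:E))%E.
  move=> k0; rewrite ge0_integralZl//; last first.
    by apply/measurable_EFinP; exact: measurable_indic.
  by rewrite integral_indic// setIT.
have mZ (k : \bar R) : measurable_fun setT
    (fun y : borel N => (k * (\1_(rball x0 r) y)%:E)%E).
  apply: emeasurable_funM => //.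
  by apply/measurable_EFinP; exact: measurable_indic.
have count0 (T : choiceType) (B : set T) : (0 <= counting B :> \bar R)%E.
  rewrite -(_ : counting (set0 : set T) = 0%E); first exact/counting_le/card_ge0.
  by rewrite /counting asboolT// fset_set0 finmap.cardfs0.
split.
- (* at most one point of the ball above y for each deck transformation *)
  have [mfib ->] := fibE r; rewrite countZ//.
  apply: ge0_le_integral => // y _; rewrite indicE.
  have [|yball] := boolP (y \in rball x0 r); last first.
    rewrite mule0 (_ : [set i | _] = set0) ?/counting ?asboolT ?fset_set0//.
    rewrite -subset0 => i [z [xz _] pzy]; move/negP: yball; apply; apply/mem_set.
    by rewrite -pzy -hx0; exact: rball_project.
  move=> /set_mem xy; rewrite mule1.
  have [z [xz pz]] : exists z, rball xb0 r z /\ p z = y.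
    by move: xy; rewrite -hx0 => /(rball_lift cov hmetric)[z]; exists z.
  apply: (@counting_le_rel _ _ _ _ _ (fun i g => A i (g z))).
    move=> i [w [xw Aw] pw].
    have [g gG gz] := normal z w (etrans pz (esym pw)).
    exists g; last by rewrite gz.
    by apply: (deck_disp_rball cov hmetric gG xz); rewrite gz.
  by move=> i j g _ _ Ai Aj; apply: tA => //; exists (g z).
- (* at least one point of the ball above y for each deck transformation *)
  have [mfib ->] := fibE (2 * r); rewrite countZ//.
  apply: ge0_le_integral => // [y _|y _]; first by rewrite mule_ge0.
  rewrite indicE; have [|_] := boolP (y \in rball x0 r); last by rewrite mule0.
  move=> /set_mem xy; rewrite mule1.
  have [z [xz pz]] : exists z, rball xb0 r z /\ p z = y.
    by move: xy; rewrite -hx0 => /(rball_lift cov hmetric)[z]; exists z.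
  have pgz g : deck p g -> p (g z) = y.
    by move=> [_ pg _]; rewrite -pz -[in RHS]pg.
  apply: (@counting_le_rel _ _ _ _ _ (fun g i => A i (g z))).
    move=> g gD; have [i _ Ai] : (\bigcup_i A i) (g z) by rewrite UA.
    exists i => //; exists (g z); last by apply: pgz; case: gD.
    by split=> //; exact: (rball_deck_disp cov hmetric gD xz).
  move=> g h i [gG _] [hG _] Ag Ah.
  apply: (deck_eq cov gG hG (x := z)); apply: (patchA i).1.
  + exact: mem_set.
  + exact: mem_set.
  + by rewrite !pgz.
Qed.
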